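(* For every positive integer $d$ there exists $v(d)>0$, and for every integer $p\ge d+1$ there exists an integer $r=r(p,d)$, such that the following holds. Let $\mathcal{F}$ be a finite family of convex sets in $\mathbb{R}^d$, each of volume at least $1$, such that among any $p$ members of $\mathcal{F}$ there exist $d+1$ whose intersection has volume at least $1$. Then $\mathcal{F}$ has a quantitative $v(d)$-transversal of size at most $r$.
   Context: $\mathrm{vol}$ denotes $d$-dimensional Lebesgue measure. For $v>0$, a family $T$ of convex bodies (compact convex sets with nonempty interior), each of volume $v$, is a quantitative $v$-transversal of a family $\mathcal{F}$ of convex sets if every member of $\mathcal{F}$ contains at least one member of $T$. (In fact the members of $T$ can be taken to be ellipsoids of volume $v(d)$.) *)

(* Defs.v *)
From HB Require Import structures.
From mathcomp Require Import all_boot all_order all_algebra.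
From mathcomp Require Import all_classical all_reals all_analysis.
Set Implicit Arguments. Unset Strict Implicit. Unset Printing Implicit Defensive.
Import Order.TTheory GRing.Theory Num.Theory.
Import numFieldNormedType.Exports.
Local Open Scope classical_set_scope.
Local Open Scope ring_scope.

Section Defs.
Variables (R : realType) (d : nat).

Definition box (a b : 'rV[R]_d) : set 'rV[R]_d :=
  [set x | forall i : 'I_d, a 0 i <= x 0 i <= b 0 i].

Definition box_vol (a b : 'rV[R]_d) : R :=
  \prod_(i < d) Num.max 0 (b 0 i - a 0 i).

(* d-dimensional Lebesgue (outer) measure: infimum of total volumes of
   countable box covers.  On Lebesgue measurable sets (in particular on all
   convex sets) this is the Lebesgue measure vol. *)
Definition vol (A : set 'rV[R]_d) : \bar R :=
  ereal_inf [set s : \bar R | exists a b : nat -> 'rV[R]_d,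
     A `<=` \bigcup_n box (a n) (b n) /\
     s = (\sum_(0 <= n <oo) (box_vol (a n) (b n))%:E)%E].

Definition convex (A : set 'rV[R]_d) : Prop :=
  forall x y (t : R), A x -> A y -> 0 <= t <= 1 ->
    A (t *: x + (1 - t) *: y).

Definition convex_body (K : set 'rV[R]_d) : Prop :=
  compact K /\ convex K /\ (K°) !=set0.

Definition quant_transversal (v : R) (T : seq (set 'rV[R]_d))
    (n : nat) (F : 'I_n -> set 'rV[R]_d) : Prop :=
  (forall K, K \in T -> convex_body K /\ vol K = v%:E) /\
  (forall i : 'I_n, exists2 K, K \in T & K `<=` F i).

End Defs.

(* Main.v *)
(** A convex set of volume at least 1 contains a parallelepiped [x + [-1,1]^d L] with
    [L] upper triangular and [\prod_i L i i] bounded below.  Parallelepipeds of this kind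
    contained in a fixed convex set form a convex subset of R^(d + d^2), by concavity of
    the logarithm, so the theorem reduces to piercing these lifted sets by few points:
    a (p', D+1) problem in dimension D = d + d^2.
    The (p, d+1) hypothesis only controls intersections of d+1 sets.  By a product Ramsey
    argument, p' sets contain a complete (d+1)-partite subfamily all of whose
    transversals have fat intersections, and a colourful volumetric Helly theorem, proved
    by induction on d through slices, then yields D+1 members with a fat intersection.
    The (p', D+1) problem is solved along the lines of Alon and Kleitman: a fractional
    Helly theorem gives deep points for arbitrary weights, multiplicative weights turn
    these into a multiset of points of which every set contains a positive proportion,
    and a weak epsilon-net, built from Tverberg partitions, concludes.  The points found
    encode parallelepipeds, which are shortened along one edge to a common volume. *)
Require Import Defs.
From HB Require Import structures.
From mathcomp Require Import all_boot all_order all_algebra.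
From mathcomp Require Import all_classical all_reals all_analysis.
From mathcomp Require Import zify ring lra.
Import Order.TTheory GRing.Theory Num.Theory.
Import numFieldNormedType.Exports.
Set Implicit Arguments.
Unset Strict Implicit.
Unset Printing Implicit Defensive.
Local Open Scope classical_set_scope.
Local Open Scope ring_scope.

(** The obstacle is the gap between two Helly numbers. Lifting turns parallelepipeds into points of
    R^D, so piercing the lifted sets asks for D + 1 of them to meet, while the hypothesis only
    speaks of d + 1 sets. The colourful theorem bridges the gap because it returns as many members
    of one class as desired. Since v is fixed before p, Ramsey numbers may grow with p, but the loss
    of fatness may depend on d alone. This dictates the order of the quantifiers in [interval_box],
    [rainbow_fat], [fat_subfamily] and [lifted_pq]. Triangularity is what makes the lifted sets
    convex: for general matrices the condition that the absolute determinant be at least c is not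
    convex, as L and -L have midpoint 0. Volume enters through covers and exact scaling under
    triangular maps only. Fatness by iterated slices takes the place of Fubini, and v is a multiple
    of the volume of the cube, whose value is never computed. *)

(** * Ramsey theory for transversals of several classes *)

Definition fcons (T : Type) n (a : T) (f : 'I_n -> T) : 'I_n.+1 -> T :=
  fun i => oapp f a (unlift ord0 i).

Lemma fcons0 (T : Type) n (a : T) (f : 'I_n -> T) : fcons a f ord0 = a.
Proof. by rewrite /fcons unlift_none. Qed.

Lemma fconsS (T : Type) n (a : T) (f : 'I_n -> T) i :
  fcons a f (lift ord0 i) = f i.
Proof. by rewrite /fcons liftK. Qed.

Lemma fcons_eta (T : Type) n (f : 'I_n.+1 -> T) :
  f = fcons (f ord0) (fun i => f (lift ord0 i)).
Proof.
apply: funext => i; case: (unliftP ord0 i) => [j|] ->.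
  by rewrite fconsS.
by rewrite fcons0.
Qed.

Lemma card_injection (T : finType) (A : {pred T}) n : (n <= #|A|)%N ->
  exists2 e : 'I_n -> T, injective e & forall i, e i \in A.
Proof.
move=> leA; exists (fun i => enum_val (widen_ord leA i)).
  by move=> i j /enum_val_inj /(congr1 val) /= ij; apply: val_inj.
by move=> i; apply: enum_valP.
Qed.

Lemma pigeonhole_fiber (T C : finType) (f : T -> C) n : (#|C| * n < #|T|)%N ->
  exists c, (n <= #|[pred x | f x == c]|)%N.
Proof.
move=> lt; apply: contrapT => /forallNP nex.
have : (#|T| <= #|C| * n)%N; last by rewrite leqNgt lt.
have -> : #|T| = (\sum_(c : C) #|[pred x | f x == c]|)%N.
  rewrite -sum1_card (partition_big f xpredT) //=.
  by apply: eq_bigr => c _; rewrite -sum1_card; apply: eq_bigl => x; rewrite !inE.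
rewrite -sum_nat_const; apply: leq_sum => c _.
by have /negP := nex c; rewrite -ltnNge => /ltnW.
Qed.

(** Fix [n0] elements of the first class and colour a transversal of the other classes by the whole
    function sending each of them to the colour of the extended transversal. Once induction has made
    this function constant, the pigeonhole principle selects [t'] of the [n0] elements. *)
Lemma product_ramsey k t' : forall C : finType, exists t0, forall t,
  (t0 <= t)%N -> forall chi : ('I_k -> 'I_t) -> C,
  exists (e : 'I_k -> 'I_t' -> 'I_t) (c : C), (forall i, injective (e i)) /\
    forall y : 'I_k -> 'I_t', chi (fun i => e i (y i)) = c.
Proof.
elim: k => [|k IH] C.
  exists 0%N => t _ chi.
  have absurd0 (i : 'I_0) : False by case: i.
  exists (fun i _ => False_rect _ (absurd0 i)).
  exists (chi (fun i => False_rect _ (absurd0 i))).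
  by split=> [i|y]; [case: (absurd0 i)|congr chi; apply: funext => i; case: (absurd0 i)].
pose n0 := (#|C| * t').+1.
have [t1 Ht1] := IH {ffun 'I_n0 -> C}.
exists (maxn t1 n0) => t; rewrite geq_max => /andP[le1 le0] chi.
pose psi (z : 'I_k -> 'I_t) : {ffun 'I_n0 -> C} :=
  [ffun j => chi (fcons (widen_ord le0 j) z)].
have [e [g [einj eg]]] := Ht1 t le1 psi.
have [|c cP] := @pigeonhole_fiber _ _ g t'; first by rewrite card_ord.
have [h hinj hP] := card_injection cP.
exists (fcons (fun j => widen_ord le0 (h j)) e), c; split.
  move=> i; case: (unliftP ord0 i) => [j|] ->.
    by rewrite fconsS; apply: einj.
  rewrite fcons0 => a b /(congr1 val) /= ab; apply: hinj; exact: val_inj.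
move=> y; have := hP (y ord0); rewrite inE => /eqP <-.
rewrite -(eg (fun i => y (lift ord0 i))) ffunE; congr chi.
rewrite [LHS]fcons_eta fcons0; congr fcons; apply: funext => i; by rewrite fconsS.
Qed.

Lemma widen_ord_injective m n (le_mn : (m <= n)%N) : injective (widen_ord le_mn).
Proof. by move=> i j /(congr1 val) /= ij; apply: val_inj. Qed.

Lemma finite_argmin (R : realType) (T : finType) (P : T -> Prop) (f : T -> R) :
  (exists x, P x) -> exists2 x, P x & forall y, P y -> f x <= f y.
Proof.
move=> [x0 Px0].
have Px0' : [pred x | `[< P x >]] x0 by apply/asboolP.
case: (arg_minP f Px0') => x /= /asboolP Px minx.
by exists x => // y Py; apply: minx; apply/asboolP.
Qed.

(** * Intervals of heights attached to transversals *)

(** Below, [q i = dilation i * len] is a margin around [[a, b]]. If an interval inside margin [q i]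
    is exchanged for one that leaves margin [q i.+1], the recursion is exactly what keeps the weight
    of the former at least 1/2 at all points up to distance [len] beyond margin [q i], on the side
    of the exit. *)
Fixpoint dilation (i : nat) : nat := if i is j.+1 then 3 * dilation j + 3 else 0.

Lemma dilation_le i j : (i <= j)%N -> (dilation i <= dilation j)%N.
Proof. by move=> /subnK <-; elim: (j - i)%N => //= n IH; lia. Qed.

(* The fixed interval [x0, x0 + h] plays the role of a common interval of heights: when
   the intervals of the transversals do not share one directly, it lies between the
   intervals of two transversals differing in the single class [r]. *)
Lemma interval_box (k t2 : nat) : exists t, (t2 <= t)%N /\
  forall (R : realType) (s del : ('I_k.+1 -> 'I_t) -> R), (forall J, 0 < del J) ->
  exists (r : 'I_k.+1) (e : 'I_k.+1 -> 'I_t2 -> 'I_t) (x0 h : R),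
  [/\ 0 < h, forall c, injective (e c) &
  forall y : 'I_k.+1 -> 'I_t2, exists J J' : 'I_k.+1 -> 'I_t,
  [/\ forall c, c != r -> J c = e c (y c) /\ J' c = e c (y c),
      del J <= (8 * (1 + 2 * dilation k.+1))%:R * h &
      forall x, x0 <= x <= x0 + h -> exists sg rho th,
        [/\ s J <= sg <= s J + del J, s J' <= rho <= s J' + del J',
            2^-1 <= th <= 1 & x = th * sg + (1 - th) * rho]]].
Proof.
set m := k.+1; set Rm := dilation m.
have [t10 Ht10] := product_ramsey (m + m) t2 ('I_m * bool)%type.
pose t1 := maxn (maxn t10 t2) 1.
have t1_gt0 : (0 < t1)%N by rewrite leq_max orbT.
have le10 : (t10 <= t1)%N by rewrite !leq_max leqnn.
have le12 : (t2 <= t1)%N by rewrite !leq_max leqnn orbT.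
pose Ng := (8 * (1 + 2 * Rm))%N.
have [t0 Ht0] := product_ramsey m t1 (bool * bool * 'I_Ng.+1)%type.
pose t := maxn t0 t1.
have let0 : (t0 <= t)%N by rewrite leq_max leqnn.
have let1 : (t1 <= t)%N by rewrite leq_max leqnn orbT.
exists t; split; first exact: leq_trans le12 let1.
move=> R s del del0.
pose i1 : 'I_t1 := Ordinal t1_gt0.
have hull (e : 'I_m -> 'I_t1 -> 'I_t) : exists J1 J2 : {ffun 'I_m -> 'I_t1},
    forall y : 'I_m -> 'I_t1, s (fun c => e c (J1 c)) <= s (fun c => e c (y c)) /\
    s (fun c => e c (y c)) + del (fun c => e c (y c))
      <= s (fun c => e c (J2 c)) + del (fun c => e c (J2 c)).
  have [|J1 _ H1] := @finite_argmin R {ffun 'I_m -> 'I_t1} (fun=> True)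
    (fun J => s (fun c => e c (J c))); first by exists [ffun=> i1].
  have [|J2 _ H2] := @finite_argmin R {ffun 'I_m -> 'I_t1} (fun=> True)
    (fun J => - (s (fun c => e c (J c)) + del (fun c => e c (J c)))).
    by exists [ffun=> i1].
  exists J1, J2 => y; have := H1 [ffun c => y c] I; have := H2 [ffun c => y c] I.
  have -> : (fun c => e c ([ffun c0 => y c0] c)) = (fun c => e c (y c)).
    by apply: funext => c; rewrite ffunE.
  by rewrite lerN2.
pose inside (a b : R) J := a <= s J /\ s J + del J <= b.
(* Candidate spans of subgrids with [t1] indices per class. Their end points come from intervals of
   transversals, so finitely many compete and a shortest one, [[a, b]] of length [len], exists. *)
pose P (J12 : {ffun 'I_m -> 'I_t} * {ffun 'I_m -> 'I_t}) :=
  exists2 e : 'I_m -> 'I_t1 -> 'I_t, (forall c, injective (e c)) &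
   forall y, inside (s J12.1) (s J12.2 + del J12.2) (fun c => e c (y c)).
have Phull (e : 'I_m -> 'I_t1 -> 'I_t) : (forall c, injective (e c)) ->
    exists2 J12, P J12 & forall a b, (forall y, inside a b (fun c => e c (y c))) ->
      (s J12.2 + del J12.2) - s J12.1 <= b - a.
  move=> einj; have [J1 [J2 H]] := hull e.
  have E (J : {ffun 'I_m -> 'I_t1}) :
      ([ffun c => e c (J c)] : 'I_m -> 'I_t) = (fun c => e c (J c)).
    by apply: funext => c; rewrite ffunE.
  exists ([ffun c => e c (J1 c)], [ffun c => e c (J2 c)]).
    by exists e => // y; rewrite /inside /= !E; have [] := H y.
  move=> a b ab; rewrite /= !E; have [h1 _] := ab J1; have [_ h2] := ab J2.
  exact: lerB.
have [|[J1 J2] [em emi Hem] Hmin] := @finite_argmin R _ P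
   (fun J12 => (s J12.2 + del J12.2) - s J12.1).
  have [|J12 PJ12 _] := Phull (fun=> widen_ord let1); last by exists J12.
  by move=> c; apply: widen_ord_injective.
move: Hem Hmin => /=; set a := s J1; set b := s J2 + _ => Hem Hmin.
pose len := b - a.
have len0 : 0 < len.
  have [h1 h2] := Hem (fun=> i1); have := del0 (fun c => em c i1).
  rewrite /len; lra.
have minlen (e : 'I_m -> 'I_t1 -> 'I_t) a' b' : (forall c, injective (e c)) ->
    (forall y, inside a' b' (fun c => e c (y c))) -> len <= b' - a'.
  move=> /(Phull e)[J12 PJ12 H] /H; apply: le_trans; exact: Hmin.
clear Phull hull Hmin P.
have bE : b = a + len by rewrite /len; lra.
clearbody len.
pose q i : R := (dilation i)%:R * len.
have q0 : q 0%N = 0 by rewrite /q mul0r.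
have qS i : q i.+1 = 3 * q i + 3 * len.
  by rewrite /q /= natrD natrM mulrDl mulrA.
have q_ge0 i : 0 <= q i by rewrite mulr_ge0 // ltW.
have q_le i : (i <= m)%N -> q i <= q m.
  by move=> im; rewrite ler_pM2r // ler_nat dilation_le.
pose lft := a - q m; pose hh := len / 8.
have hh0 : 0 < hh by rewrite divr_gt0.
pose small J := del J <= len / 4.
pose ins i J := inside (a - q i) (b + q i) J.
(* The last entry is the cell of width [len / 8] containing the left end point; [Ng] such widths
   make up [[a - q m, b + q m]]. The cell is meaningful only when the first entry is true. *)
pose chi J : bool * bool * 'I_Ng.+1 :=
  (`[< ins m J >], `[< small J >], inord (Num.truncn ((s J - lft) / hh))).
have [ep [[[cin csm] j] [epi Hep]]] := Ht0 _ let0 chi.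
have gridP y : let J := fun c => ep c (y c) in ins m J ->
    lft + j%:R * hh <= s J < lft + j%:R * hh + hh.
  move=> J insJ; have [] := insJ; rewrite -/lft => h1 h2.
  have x0 : 0 <= (s J - lft) / hh by rewrite divr_ge0 // ?subr_ge0 // ltW.
  have /(congr1 snd) /= := Hep y; rewrite -/J => /(congr1 val) /=.
  have Hlt : (Num.truncn ((s J - lft) / hh) < Ng.+1)%N.
    have /andP[g1 _] := truncn_itv x0.
    rewrite ltnS -(ler_nat R) (le_trans g1) // ler_pdivrMr //.
    rewrite /Ng natrM natrD natrM -/Rm.
    have := del0 J; have : q m = Rm%:R * len by [].
    rewrite /hh /lft; move: h2 bE; lra.
  rewrite inordK // => <-.
  have /andP[g1 g2] := truncn_itv x0.
  move: g1 g2; rewrite ler_pdivlMr // ltr_pdivrMr // -natr1; lra.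
have cinP y : cin = `[< ins m (fun c => ep c (y c)) >].
  by have /(congr1 fst) /(congr1 fst) /= := Hep y.
have csmP y : csm = `[< small (fun c => ep c (y c)) >].
  by have /(congr1 fst) /(congr1 snd) /= := Hep y.
case: cin cinP {Hep} => cinP; last first.
  (* the interval of a rainbow tuple leaves the small one as colours are switched *)
  pose path (y : 'I_(m + m) -> 'I_t1) i : 'I_m -> 'I_t := fun c =>
    if (c < i)%N then ep c (y (rshift m c)) else em c (y (lshift m c)).
  have jump y : exists ib : 'I_m * bool, ins ib.1 (path y ib.1) /\
      if ib.2 then b + q ib.1.+1 < s (path y ib.1.+1) + del (path y ib.1.+1)
      else s (path y ib.1.+1) < a - q ib.1.+1.
    apply: contrapT => /forallNP nj.
    have H i : (i <= m)%N -> ins i (path y i).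
      elim: i => [_|i IH im].
        rewrite /ins q0 subr0 addr0.
        have -> : path y 0%N = (fun c => em c (y (lshift m c))) by apply: funext.
        exact: (Hem (fun c => y (lshift m c))).
      have {}IH := IH (ltnW im).
      split; rewrite leNgt; apply/negP => lt.
        by apply: (nj (Ordinal im, false)).
      by apply: (nj (Ordinal im, true)).
    have := H m (leqnn m).
    have -> : path y m = (fun c => ep c (y (rshift m c))).
      by apply: funext => c; rewrite /path ltn_ord.
    by move=> insm; have := cinP (fun c => y (rshift m c)); rewrite (asboolT insm).
  have [es [[i sd] [esi Hes]]] := Ht10 _ le10 (fun y => sval (cid (jump y))).
  exists i, (fun (c : 'I_m) x => if (c < i)%N then ep c (es (rshift m c) x)
                        else em c (es (lshift m c) x)).
  exists (if sd then b + q i else a - q i - len), len; split => //.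
    by move=> c x1 x2; case: ifP => _ H; apply: esi; [apply: epi H|apply: emi H].
  move=> y.
  (* Both copies of class [c], the one read by [em] and the one read by [ep], receive the same index
     [y c]. *)
  pose yy (p : 'I_(m + m)) : 'I_t2 := match fintype.split p with inl c => y c | inr c => y c end.
  have := svalP (cid (jump (fun p => es p (yy p)))); rewrite Hes /=.
  set J := path _ i; set J' := path _ i.+1 => -[[h1 h2] h3].
  have yl c : yy (lshift m c) = y c.
    by rewrite /yy; case: split_ordP => c' /eqP; rewrite (eq_lshift, eq_lrshift) // => /eqP->.
  have yr c : yy (rshift m c) = y c.
    by rewrite /yy; case: split_ordP => c' /eqP; rewrite (eq_rshift, eq_rlshift) // => /eqP->.
  exists J, J'; split.
  - move=> c; rewrite -val_eqE /= => /negP ci; rewrite /J /J' /path yl yr.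
    split=> //; rewrite ltnS leq_eqVlt; case: eqP => //= ci'; case: ci; exact/eqP.
  - have qi := q_le i (ltnW (ltn_ord i)); have qmE : q m = Rm%:R * len by [].
    rewrite natrM natrD natrM -/Rm.
    move: h1 h2 qi (q_ge0 m) bE; rewrite qmE; lra.
  - move=> x; have := q_ge0 i; have := qS i; have := del0 J'; have := del0 J.
    case: sd h3 {Hes} => h3 d1 d2 qi qi0 xI.
    + pose rho := s J' + del J'; pose th := (rho - x) / (rho - s J).
      have d3 : 0 < rho - s J by rewrite /rho; lra.
      exists (s J), rho, th; split; [lra|rewrite /rho; lra| |].
        by rewrite /th ler_pdivlMr // ler_pdivrMr //; rewrite /rho; lra.
      by rewrite /th; field; rewrite gt_eqF.
    + pose rho := s J'; pose th := (rho - x) / (rho - s J).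
      have d3 : 0 < s J - rho by rewrite /rho; lra.
      have d4 : rho - s J != 0 by rewrite lt_eqF // -oppr_gt0 opprB.
      exists (s J), rho, th; split; [lra|rewrite /rho; lra| |].
        have -> : th = (x - rho) / (s J - rho) by rewrite /th -[x - rho]opprB -[s J - rho]opprB invrN mulrNN.
        by rewrite ler_pdivlMr // ler_pdivrMr //; rewrite /rho; lra.
      by rewrite /th; field.
have insP y : ins m (fun c => ep c (y c)) by apply/asboolP; rewrite -cinP.
(* Short intervals starting in a common cell would all fit into an interval of length [len / 2],
   against the minimality of [len]. *)
case: csm csmP => csmP.
  have smP y : small (fun c => ep c (y c)) by apply/asboolP; rewrite -csmP.
  suff : len <= (lft + j%:R * hh + len / 2) - (lft + j%:R * hh) by move: len0; lra.
  apply: (minlen ep) => // y.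
  have /andP[g1 g2] := gridP y (insP y); have := smP y.
  rewrite /small /inside => h; split=> //; move: g2; rewrite /hh; lra.
exists ord0, (fun c x => ep c (widen_ord le12 x)), (lft + j%:R * hh + hh), hh.
split=> // [c x y /epi /(congr1 val) /= xy|y]; first exact: val_inj.
set J := fun c => ep c (widen_ord le12 (y c)).
have /andP[g1 g2] : lft + j%:R * hh <= s J < lft + j%:R * hh + hh.
  exact: (gridP (fun c => widen_ord le12 (y c)) (insP _)).
have [h1 h2] : ins m J := insP _.
have big : len / 4 < del J.
  rewrite ltNge; apply/negP => sm.
  by have := csmP (fun c => widen_ord le12 (y c)); rewrite (asboolT sm).
exists J, J; split=> //.
  have qmE : q m = Rm%:R * len by [].
  rewrite /hh natrM natrD natrM -/Rm; move: h1 h2 bE (q_ge0 m); rewrite qmE; lra.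
move=> x xI; exists x, x, 1; split; [|by move: xI g1 g2 big; rewrite /hh; lra|lra|lra].
by move: xI g1 g2 big; rewrite /hh; lra.
Qed.

(** * Fatness by iterated slices *)

Definition slice (R : realType) d (K : set 'rV[R]_(1 + d)) (s : R) : set 'rV[R]_d :=
  [set y | K (row_mx s%:M y)].

Lemma row_mx_scalar (R : realType) d (x : 'rV[R]_(1 + d)) :
  x = row_mx (lsubmx x 0 0)%:M (rsubmx x).
Proof. by rewrite -mx11_scalar hsubmxK. Qed.

Lemma row_mx_combination (R : realType) d (c e s t : R) (x y : 'rV[R]_d) :
  c *: row_mx s%:M x + e *: row_mx t%:M y
  = row_mx (c * s + e * t)%:M (c *: x + e *: y) :> 'rV[R]_(1 + d).
Proof. by rewrite !scale_row_mx add_row_mx !scale_scalar_mx -raddfD. Qed.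

Lemma convex_slice (R : realType) d (K : set 'rV[R]_(1 + d)) s :
  convex K -> convex (slice K s).
Proof.
move=> cK x y t Kx Ky t01; rewrite /slice /=.
have := cK _ _ t Kx Ky t01; rewrite row_mx_combination.
by rewrite -mulrDl addrC subrK mul1r.
Qed.

Lemma convex_bigcap (R : realType) d (I : Type) (K : I -> set 'rV[R]_d) :
  (forall i, convex (K i)) -> convex [set x | forall i, K i x].
Proof. by move=> cK x y t Kx Ky t01 i; apply: cK. Qed.

(* [rfat K v] says that K contains a body sliced by the first coordinate over
   an interval of length [del] into (d-1)-dimensional ones of size [v / del]. *)
Fixpoint rfat (R : realType) d : set 'rV[R]_d -> R -> Prop :=
  match d with
  | 0 => fun K v => v <= 1 /\ K 0
  | d'.+1 => fun K v => exists s del, 0 < del /\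
      forall tau, s <= tau <= s + del -> rfat (@slice R d' K tau) (v / del)
  end.

Lemma rfat_mono (R : realType) d (K K' : set 'rV[R]_d) v v' :
  K `<=` K' -> v' <= v -> rfat K v -> rfat K' v'.
Proof.
elim: d K K' v v' => [|d IH] K K' v v' KK' vv' /=.
  by move=> [v1 K0]; split; [exact: le_trans v1|exact: KK'].
move=> [s [del [del0 H]]]; exists s, del; split=> // tau /H; apply: IH.
  by move=> y; apply: KK'.
by rewrite ler_pM2r // invr_gt0.
Qed.

Lemma rfat_nonempty (R : realType) d (K : set 'rV[R]_d) v :
  rfat K v -> exists x, K x.
Proof.
elim: d K v => [|d IH] K v /=; first by move=> [_ ?]; exists 0.
move=> [s [del [del0 H]]]; have [|y Ky] := IH _ _ (H s _).
  by rewrite lexx lerDl ltW.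
by exists (row_mx s%:M y).
Qed.

Lemma rfat_shrink (R : realType) d (A A' : set 'rV[R]_d) (b : 'rV[R]_d) c v :
  0 < c -> (forall a, A a -> A' (c *: a + (1 - c) *: b)) ->
  rfat A v -> rfat A' (c ^+ d * v).
Proof.
move=> c0; elim: d A A' b v => [|d IH] A A' b v AA' /=.
  move=> [v1 A0]; rewrite expr0 mul1r; split=> //.
  by have := AA' _ A0; rewrite [X in A' X]thinmx0.
move=> [s [del [del0 H]]].
pose b0 := (lsubmx (b : 'rV_(1 + d))) 0 0.
exists (c * s + (1 - c) * b0), (c * del); split; first exact: mulr_gt0.
move=> tau tauI; pose tau' := (tau - (1 - c) * b0) / c.
have tauE : tau = c * tau' + (1 - c) * b0.
  by rewrite /tau' mulrC divfK ?gt_eqF // subrK.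
have -> : c ^+ d.+1 * v / (c * del) = c ^+ d * (v / del).
  by rewrite exprS; field; rewrite !gt_eqF.
apply: (IH (slice A tau') _ (rsubmx (b : 'rV_(1 + d)))); last first.
  apply: H; rewrite /tau' ler_pdivlMr // ler_pdivrMr //.
  by move: tauI; lra.
move=> y Ay; rewrite /slice /= tauE -row_mx_combination -row_mx_scalar.
exact: AA'.
Qed.

(** The cone with apex [y] over the slice at [a] lies in [K]; its section at the intermediate height
    is that slice contracted by [c]. *)
Lemma rfat_slice_interp (R : realType) d (K : set 'rV[R]_(1 + d)) a b c v y :
  convex K -> 0 < c <= 1 -> rfat (slice K a) v -> slice K b y ->
  rfat (slice K (c * a + (1 - c) * b)) (c ^+ d * v).
Proof.
move=> cK /andP[c0 c1] fa Kb; apply: (@rfat_shrink _ _ (slice K a) _ y) fa => // z Kz.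
by rewrite /slice /= -row_mx_combination; apply: cK => //; rewrite (ltW c0).
Qed.

Lemma half_exp_le (R : realType) d (c v : R) :
  2^-1 <= c -> 0 <= v -> 2^-1 ^+ d * v <= c ^+ d * v.
Proof. by move=> hc v0; rewrite ler_wpM2r // lerXn2r // nnegrE; lra. Qed.

(** Only the half of the segment of heights nearer to [a] is used: there the contraction factor is
    at least 1/2. *)
Lemma rfat_two_slices (R : realType) d (K : set 'rV[R]_(1 + d)) a b v :
  convex K -> a != b -> 0 <= v -> rfat (slice K a) v -> (exists y, slice K b y) ->
  rfat (K : set 'rV_d.+1) (2^-1 ^+ d * v * (`|b - a| / 2)).
Proof.
move=> cK ab v0 fa [y Kb].
have key tau c : 2^-1 <= c <= 1 -> tau = c * a + (1 - c) * b ->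
    rfat (slice K tau) (2^-1 ^+ d * v).
  move=> /andP[c1 c2] ->.
  have c01 : 0 < c <= 1 by apply/andP; split=> //; lra.
  exact: rfat_mono (@subset_refl _ _) (half_exp_le _ c1 v0)
    (rfat_slice_interp cK c01 fa Kb).
have [lt|lt|eq] := ltrgtP a b; last by rewrite eq eqxx in ab.
- have h : 0 < (b - a) / 2 by rewrite divr_gt0 // subr_gt0.
  exists a, ((b - a) / 2); split=> // tau tauI; rewrite (mulfK (lt0r_neq0 h)).
  apply: (key _ ((b - tau) / (b - a))); last by field; rewrite gt_eqF ?subr_gt0.
  by rewrite ler_pdivlMr ?subr_gt0 // ler_pdivrMr ?subr_gt0 //; lra.
- have h : 0 < (a - b) / 2 by rewrite divr_gt0 // subr_gt0.
  exists (a - (a - b) / 2), ((a - b) / 2); split=> // tau tauI.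
  rewrite (mulfK (lt0r_neq0 h)).
  apply: (key _ ((tau - b) / (a - b))); last by field; rewrite gt_eqF ?subr_gt0.
  by rewrite ler_pdivlMr ?subr_gt0 // ler_pdivrMr ?subr_gt0 //; lra.
Qed.

(** The colourful volumetric Helly property in dimension [d]. The constant [cd] precedes [N]:
    collecting more members of a class costs a larger [t], never fatness. *)
Definition rainbow_fat (R : realType) d (cd : R) := forall N, exists t, (N <= t)%N /\
  forall (K : 'I_d.+1 -> 'I_t -> set 'rV[R]_d) v, 0 < v ->
  (forall c i, convex (K c i)) ->
  (forall y : 'I_d.+1 -> 'I_t, rfat [set z | forall c, K c (y c) z] v) ->
  exists (c : 'I_d.+1) (u : 'I_N -> 'I_t), injective u /\
    rfat [set z | forall j, K c (u j) z] (cd * v).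

Lemma rainbow_fat0 (R : realType) : @rainbow_fat R 0 1.
Proof.
(* With [N.+1] indices a rainbow tuple exists even for [N = 0], and it provides [v <= 1]. *)
move=> N; exists N.+1; split=> // K v v0 _ H.
exists ord0, (widen_ord (leqnSn N)); split; first exact: widen_ord_injective.
have [v1 _] := H (fun=> ord0).
split=> [|j]; first by rewrite mul1r.
by have [_ /(_ ord0)] := H (fun=> widen_ord (leqnSn N) j).
Qed.

(** Heights are treated one by one. Each new height thins one class by [rainbow_fat] and merely
    truncates the others; fat intersections found at earlier heights survive, having fewer sets to
    meet. *)
Lemma rainbow_fat_slices (R : realType) d (cd : R) m N : 0 < cd -> @rainbow_fat R d cd ->
  exists t, (N <= t)%N /\
  forall (K : 'I_d.+1 -> 'I_t -> set 'rV[R]_(1 + d)) (x : 'I_m -> R) v, 0 < v ->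
  (forall c i, convex (K c i)) ->
  (forall i (y : 'I_d.+1 -> 'I_t), rfat (slice [set z | forall c, K c (y c) z] (x i)) v) ->
  exists (col : 'I_m -> 'I_d.+1) (u : 'I_d.+1 -> 'I_N -> 'I_t),
    (forall c, injective (u c)) /\
    forall i, rfat (slice [set z | forall j, K (col i) (u (col i) j) z] (x i)) (cd * v).
Proof.
move=> cd0 Td; elim: m N => [|m IH] N.
  exists N; split=> // K x v v0 _ _; exists (fun=> ord0), (fun=> id).
  by split=> [c i j|[]].
have [N' [leN HN']] := Td N.
have [t [let' Ht]] := IH N'.
exists t; split; first exact: leq_trans leN let'.
move=> K x v v0 cK HK.
have [col [u [uinj Hu]]] := Ht K (fun i => x (lift ord0 i)) v v0 cK (fun i => HK _).
have [||c [w [winj Hw]]] := HN' (fun c i => slice (K c (u c i)) (x ord0)) v v0.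
- by move=> c i; apply: convex_slice; apply: cK.
- by move=> y; apply: HK.
pose g c' : 'I_N -> 'I_N' := if c' == c then w else widen_ord leN.
have ginj c' : injective (g c').
  by rewrite /g; case: eqP => // _; apply: widen_ord_injective.
exists (fcons c col), (fun c' j => u c' (g c' j)); split.
  by move=> c' i j /uinj; apply: ginj.
move=> i; case: (unliftP ord0 i) => [j|] ->.
  rewrite fconsS; apply: rfat_mono (Hu j) => // z Hz k; exact: Hz.
by rewrite fcons0 /g eqxx; apply: rfat_mono Hw.
Qed.


(* If the slices at two different heights contain fat intersections of members of the
   same class, the intersection itself is fat in dimension [d + 1]. *)
Lemma rainbow_fatS (R : realType) d (cd : R) : 0 < cd -> @rainbow_fat R d cd ->
  exists2 cd', 0 < cd' & @rainbow_fat R d.+1 cd'.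
Proof.
move=> cd0 Td.
pose C : R := (8 * (1 + 2 * dilation d.+2))%:R.
have C0 : 0 < C by rewrite ltr0n muln_gt0 /= addn_gt0.
pose ka : R := 2^-1 ^+ d / C.
have p0 : 0 < 2^-1 ^+ d :> R by rewrite exprn_gt0 // invr_gt0.
have ka0 : 0 < ka by rewrite divr_gt0.
pose n2 : R := d.+2%:R.
have n20 : 0 < n2 by rewrite ltr0n.
exists (2^-1 ^+ d * (cd * ka) / (2 * n2)).
  by apply: divr_gt0; apply: mulr_gt0 => //; apply: mulr_gt0.
move=> N; have [t2 [leN Ht2]] := rainbow_fat_slices d.+2 N cd0 Td.
have [t [le2 Ht]] := interval_box d.+1 t2.
exists t; split; first exact: leq_trans leN le2.
move=> K v v0 cK HK.
have [sd sdP] := choice HK.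
have {sdP} [del sdP] := choice sdP.
have del0 J : 0 < del J by have [] := sdP J.
have HJ J tau : sd J <= tau <= sd J + del J ->
    rfat (slice [set z | forall c, K c (J c) z] tau) (v / del J).
  by have [_] := sdP J; apply.
have [r [e [x0 [h [h0 einj box]]]]] := Ht R sd del del0.
(* Setting class [r] aside leaves [d.+1] classes, the number that dimension [d] requires. *)
pose K' c j := K (lift r c) (e (lift r c) j).
have cK' c j : convex (K' c j) by apply: cK.
have good x (y : 'I_d.+1 -> 'I_t2) : x0 <= x <= x0 + h ->
    rfat (slice [set z | forall c, K' c (y c) z] x) (ka * v / h).
  (* The index given to class [r] is arbitrary, since [box] constrains the other classes only. *)
  move=> xI; pose y' c := if unlift r c is Some j then y j else y ord0.
  have [J [J' [JJ' delJ /(_ _ xI)[sg [rho [th [sgI rhoI /andP[th1 th2] ->]]]]]]] := box y'.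
  have sub (j : 'I_d.+2 -> 'I_t) : (forall c, c != r -> j c = e c (y' c)) ->
      [set z | forall c, K c (j c) z] `<=` [set z | forall c, K' c (y c) z].
    move=> Hj z Hz c; have := Hz (lift r c).
    by rewrite Hj ?(eq_sym _ r) ?neq_lift // /y' liftK.
  have f1 : rfat (slice [set z | forall c, K' c (y c) z] sg) (v / del J).
    apply: rfat_mono (HJ _ _ sgI) => // z.
    by apply: sub => c cr; have [] := JJ' c cr.
  have [z Hz] := rfat_nonempty (HJ _ _ rhoI).
  have f2 : slice [set z | forall c, K' c (y c) z] rho z.
    by move: Hz; apply: sub => c cr; have [] := JJ' c cr.
  have th01 : 0 < th <= 1 by rewrite th2 andbT; lra.
  apply: rfat_mono (rfat_slice_interp _ th01 f1 f2); first by [].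
    apply: le_trans (half_exp_le d th1 _); last by rewrite ltW // divr_gt0.
    rewrite /ka -!mulrA ler_wpM2l ?(ltW p0) // mulrCA ler_wpM2l ?(ltW v0) //.
    by rewrite -invfM lef_pV2 ?posrE ?mulr_gt0.
  by apply: convex_bigcap => c; apply: cK'.
(* [d.+2] heights against [d.+1] classes: two of them select the same class, and they are at least
   [h / n2] apart. *)
pose xs (i : 'I_d.+2) := x0 + i%:R / n2 * h.
have xsI i : x0 <= xs i <= x0 + h.
  have q0 : 0 <= i%:R / n2 by rewrite divr_ge0 // ltW.
  have q1 : i%:R / n2 <= 1 by rewrite ler_pdivrMr // mul1r ler_nat ltnW.
  by rewrite /xs lerDl mulr_ge0 ?(ltW h0) //= lerD2l ler_piMl // ltW.
have [col [u [uinj Hu]]] := Ht2 K' xs (ka * v / h) (divr_gt0 (mulr_gt0 ka0 v0) h0)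
  cK' (fun i y => good _ y (xsI i)).
have [i [i' [ii' colE]]] : exists i i', i != i' /\ col i = col i'.
  apply: contrapT => nex.
  have inj : injective col.
    move=> i i' E; apply/eqP/negPn/negP => ne; apply: nex; by exists i, i'.
  by have := leq_card _ inj; rewrite !card_ord ltnn.
exists (lift r (col i)), (fun j => e (lift r (col i)) (u (col i) j)).
split; first by move=> j j' /einj /uinj.
have f1 := Hu i; have f2 := rfat_nonempty (Hu i'); rewrite -colE in f2.
have ne : xs i != xs i'.
  rewrite /xs (inj_eq (addrI _)) (inj_eq (mulIf (lt0r_neq0 h0))).
  by rewrite (inj_eq (mulIf (invr_neq0 (lt0r_neq0 n20)))) eqr_nat.
have vv : 0 <= cd * (ka * v / h) by rewrite ltW // mulr_gt0 // divr_gt0 // mulr_gt0.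
apply: rfat_mono (rfat_two_slices _ ne vv f1 f2); first by [].
  have -> : xs i' - xs i = (i'%:R - i%:R) * (h / n2) by rewrite /xs; ring.
  have d1 : 1 <= `|i'%:R - i%:R| :> R.
    have [lt|lt|E] := ltngtP i i'; last by move: ii'; rewrite -val_eqE /= E eqxx.
      rewrite ger0_norm ?subr_ge0 ?ler_nat 1?ltnW //.
      by rewrite -natrB 1?ltnW // ler1n subn_gt0.
    rewrite ler0_norm ?subr_le0 ?ler_nat 1?ltnW // opprB.
    by rewrite -natrB 1?ltnW // ler1n subn_gt0.
  rewrite normrM [`|h / n2|]gtr0_norm ?divr_gt0 //.
  set q := `| _ |; rewrite -/q in d1.
  have -> : 2^-1 ^+ d * (cd * (ka * v / h)) * (q * (h / n2) / 2)
     = 2^-1 ^+ d * (cd * ka) / (2 * n2) * v * q.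
    by field; rewrite !gt_eqF.
  by rewrite ler_peMr // ltW // mulr_gt0 //; apply: divr_gt0; apply: mulr_gt0 => //; apply: mulr_gt0.
by apply: convex_bigcap => j; apply: cK'.
Qed.

Lemma rainbow_fat_exists (R : realType) d : exists2 cd, 0 < cd & @rainbow_fat R d cd.
Proof.
elim: d => [|d [cd cd0 IH]]; first by exists 1; [exact: ltr01|exact: rainbow_fat0].
exact: rainbow_fatS cd0 IH.
Qed.

(** * Convex hulls, Radon and Tverberg partitions *)

Lemma cvg_coordZ (R : realType) n D (y : 'rV[R]_D) (i : 'I_n) (w : 'rV[R]_n) :
  w' 0 i *: y @[w' --> w] --> w 0 i *: y.
Proof.
have h : w' 0 i @[w' --> w] --> w 0 i by apply: coord_continuous.
exact: cvgZr_tmp h.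
Qed.

Lemma continuous_lincomb (R : realType) n D (y : 'I_n -> 'rV[R]_D) :
  continuous (fun w : 'rV[R]_n => \sum_(i < n) w 0 i *: y i).
Proof.
elim: (index_enum _) => [|i r IH].
  have -> : (fun w : 'rV[R]_n => \sum_(i <- [::]) w 0 i *: y i) = cst 0.
    by apply: funext => w; rewrite big_nil.
  exact: cst_continuous.
have -> : (fun w : 'rV[R]_n => \sum_(j <- i :: r) w 0 j *: y j) =
    (fun w => w 0 i *: y i + \sum_(j <- r) w 0 j *: y j).
  by apply: funext => w; rewrite big_cons.
move=> w; apply: (@cvgD R 'rV[R]_D _ _ (nbhs_filter (w : 'rV[R]_n)) (fun w : 'rV[R]_n => w 0 i *: y i)
  (fun w : 'rV[R]_n => \sum_(j <- r) w 0 j *: y j)); last exact: IH.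
exact: (@cvg_coordZ R n D (y i) i w).
Qed.

Lemma compact_unit_cube (R : realType) n :
  compact [set u : 'rV[R]_n | forall i, 0 <= u 0 i <= 1].
Proof.
have -> : [set u : 'rV[R]_n | forall i, 0 <= u 0 i <= 1] =
    [set u : 'rV[R]_n | forall i, `[(0 : R), 1]%classic (u ord0 i)].
  by apply/seteqP; split=> u /= H i; have := H i; rewrite in_itv.
by apply: (@rV_compact R n (fun=> `[0, 1]%classic)) => i; apply: segment_compact.
Qed.

Definition hull (R : realType) (I : finType) D (y : I -> 'rV[R]_D) (P : pred I) :
    set 'rV[R]_D :=
  [set z | exists w : I -> R, [/\ forall i, 0 <= w i, forall i, ~~ P i -> w i = 0,
     \sum_i w i = 1 & z = \sum_i w i *: y i]].

Lemma convex_lincomb (R : realType) (I : eqType) D (K : set 'rV[R]_D) (y : I -> 'rV[R]_D)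
    (w : I -> R) (r : seq I) :
  convex K -> (forall i, 0 <= w i) -> (forall i, w i != 0 -> K (y i)) ->
  0 < \sum_(i <- r) w i ->
  K ((\sum_(i <- r) w i)^-1 *: \sum_(i <- r) w i *: y i).
Proof.
move=> cK w0 wK; elim: r => [|i r IH]; first by rewrite big_nil ltxx.
rewrite !big_cons; have [->|wi] := eqVneq (w i) 0; first by rewrite !add0r scale0r add0r.
have wi0 : 0 < w i by rewrite lt0r wi w0.
have : 0 <= \sum_(j <- r) w j by apply: sumr_ge0.
rewrite le0r => /orP[/eqP s0|s0] pos.
  rewrite s0 addr0 big_seq big1 ?addr0 ?scalerA ?mulVf ?scale1r //; first exact: wK.
  move=> j jr; suff -> : w j = 0 by rewrite scale0r.
  by apply/eqP; move/eqP: s0; rewrite psumr_eq0 // => /allP /(_ _ jr).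
have := cK _ _ (w i / (w i + \sum_(j <- r) w j)) (wK _ wi) (IH s0).
move: pos; set s := \sum_(j <- r) w j; set v := \sum_(j <- r) _ => pos.
have -> : w i / (w i + s) *: y i + (1 - w i / (w i + s)) *: (s^-1 *: v)
    = (w i + s)^-1 *: (w i *: y i + v).
  rewrite scalerDr !scalerA; congr (_ *: _ + _ *: _); first by rewrite mulrC.
  by field; rewrite (lt0r_neq0 s0) (lt0r_neq0 pos).
by apply; rewrite divr_ge0 ?(ltW pos) ?w0 //= ler_pdivrMr // mul1r lerDl ltW.
Qed.

Lemma convex_sum (R : realType) (I : finType) D (K : set 'rV[R]_D) (y : I -> 'rV[R]_D)
    (w : I -> R) :
  convex K -> (forall i, 0 <= w i) -> (forall i, w i != 0 -> K (y i)) ->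
  \sum_i w i = 1 -> K (\sum_i w i *: y i).
Proof.
move=> cK w0 wK w1; have := convex_lincomb (r := index_enum I) cK w0 wK.
by rewrite w1 invr1 scale1r; apply.
Qed.

Lemma convex_hull (R : realType) (I : finType) D (y : I -> 'rV[R]_D) (P : pred I) :
  convex (hull y P).
Proof.
move=> x x' t [w [w0 wP w1 ->]] [w' [w0' wP' w1' ->]] /andP[t0 t1].
exists (fun i => t * w i + (1 - t) * w' i); split.
- by move=> i; rewrite addr_ge0 ?mulr_ge0 ?subr_ge0.
- by move=> i Pi; rewrite wP ?wP' // !mulr0 addr0.
- by rewrite big_split /= -!mulr_sumr w1 w1' !mulr1 addrC subrK.
- rewrite !scaler_sumr -big_split /=; apply: eq_bigr => i _.
  by rewrite [RHS]scalerDl !scalerA.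
Qed.

Lemma hull_mem (R : realType) (I : finType) D (y : I -> 'rV[R]_D) (P : pred I) i :
  P i -> hull y P (y i).
Proof.
move=> Pi; exists (fun j => (j == i)%:R); split.
- by move=> j; rewrite ler0n.
- by move=> j Pj; have [ji|//] := eqVneq j i; rewrite ji Pi in Pj.
- rewrite (bigD1 i) //= eqxx big1 ?addr0 // => j ji; by rewrite (negbTE ji).
- rewrite (bigD1 i) //= eqxx scale1r big1 ?addr0 // => j ji.
  by rewrite (negbTE ji) scale0r.
Qed.

Lemma hull_sub (R : realType) (I : finType) D (y : I -> 'rV[R]_D) (P : pred I)
    (K : set 'rV[R]_D) :
  convex K -> (forall i, P i -> K (y i)) -> hull y P `<=` K.
Proof.
move=> cK yK z [w [w0 wP w1 ->]]; apply: convex_sum => // i wi0; apply: yK.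
by apply: contraNT wi0 => /wP ->.
Qed.

Lemma hull_le (R : realType) (I : finType) D (y : I -> 'rV[R]_D) (P Q : pred I) :
  (forall i, P i -> Q i) -> hull y P `<=` hull y Q.
Proof.
by move=> PQ; apply: hull_sub; [exact: convex_hull|move=> i /PQ; exact: hull_mem].
Qed.

Lemma compact_hull (R : realType) (I : finType) D (y : I -> 'rV[R]_D) (P : pred I) :
  compact (hull y P).
Proof.
pose f (w : 'rV[R]_#|I|) := \sum_(i < #|I|) w 0 i *: y (enum_val i).
pose B := [set w : 'rV[R]_#|I| | forall i, 0 <= w 0 i <= 1].
pose one (_ : 'I_#|I|) : 'rV[R]_1 := const_mx 1.
(* Weights being nonnegative, one closed equation, total weight 0 outside [P], makes each of them
   vanish there. *)
pose bad (i : 'I_#|I|) : 'rV[R]_1 := const_mx (~~ P (enum_val i))%:R.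
pose g e (w : 'rV[R]_#|I|) := \sum_(i < #|I|) w 0 i *: (e i : 'rV[R]_1).
have gE e w : g e w = const_mx (\sum_(i < #|I|) w 0 i * e i 0 0).
  by apply/rowP => k; rewrite ord1 !mxE summxE; apply: eq_bigr => i _; rewrite mxE.
have gP e w c : g e w = const_mx c -> \sum_(i < #|I|) w 0 i * e i 0 0 = c.
  by rewrite gE => /matrixP /(_ 0 0); rewrite mxE [in RHS]mxE.
have sumE (V : nmodType) (h : I -> V) : \sum_i h i = \sum_(k < #|I|) h (enum_val k).
  by rewrite (reindex (@enum_val I predT)) //; apply: onW_bij; apply: enum_val_bij.
have -> : hull y P = f @` (B `&` (g one @^-1` [set const_mx 1] `&` g bad @^-1` [set 0])).
  apply/seteqP; split=> [z [w [w0 wP w1 ->]]|_ [w [wB [/= g1 g2]] <-]].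
    have le1 i : w i <= 1.
      by rewrite -w1 (bigD1 i) //= lerDl sumr_ge0.
    exists (\row_k w (enum_val k)).
      split; first by move=> k; rewrite mxE w0 le1.
      split; rewrite /= gE.
        congr const_mx; rewrite -w1 sumE; apply: eq_bigr => k _.
        by rewrite !mxE mulr1.
      apply/rowP => k; rewrite !mxE big1 // => i _; rewrite !mxE.
      by have [Pi|/wP ->] := boolP (P (enum_val i)); rewrite ?mulr0 ?mul0r.
    by rewrite sumE; apply: eq_bigr => k _; rewrite mxE.
  have w0 k : 0 <= w 0 k by have /andP[] := wB k.
  exists (fun i => w 0 (enum_rank i)); split=> //.
  - move=> i Pi; have /gP /eqP : g bad w = const_mx 0 by rewrite [RHS]raddf0.
    rewrite psumr_eq0 => [/allP /(_ (enum_rank i) (mem_index_enum _))|k _].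
      by rewrite mxE enum_rankK Pi mulr1 => /eqP.
    by rewrite mxE mulr_ge0 // ler0n.
  - rewrite -(gP _ _ _ g1).
    by rewrite sumE; apply: eq_bigr => k _; rewrite enum_valK mxE mulr1.
  - by rewrite sumE; apply: eq_bigr => k _; rewrite enum_valK.
apply: continuous_compact; first exact/continuous_subspaceT/continuous_lincomb.
apply: compact_closedI; first exact: compact_unit_cube.
have cl e p : closed (g e @^-1` [set p]).
  apply: preimage_closed; last first.
    by apply: compact_closed; [exact: norm_hausdorff|exact: compact_set1].
  by move=> w _; apply: continuous_lincomb.
by apply: closedI.
Qed.


Lemma radon (R : realType) D (y : 'I_D.+2 -> 'rV[R]_D) :
  exists (P : pred 'I_D.+2) z, hull y P z /\ hull y (predC P) z.
Proof.
pose A : 'M[R]_(D.+2, D + 1) := \matrix_i row_mx (y i) (const_mx 1).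
have : kermx A != 0.
  rewrite -mxrank_eq0 mxrank_ker -lt0n subn_gt0.
  by apply: leq_ltn_trans (rank_leq_col A) _; rewrite addn1.
case/rowV0Pn => w /sub_kermxP wA wn0.
have [wy w1] : \sum_i w 0 i *: y i = 0 /\ \sum_i w 0 i = 0.
  move: wA; rewrite mulmx_sum_row.
  under eq_bigr do rewrite rowK scale_row_mx.
  have -> : \sum_i row_mx (w 0 i *: y i) (w 0 i *: const_mx 1 : 'rV_1)
     = row_mx (\sum_i w 0 i *: y i) (\sum_i (w 0 i *: const_mx 1)).
    elim: (index_enum _) => [|i r IH]; first by rewrite !big_nil row_mx0.
    by rewrite !big_cons IH add_row_mx.
  rewrite -row_mx0 => /eq_row_mx[-> /matrixP /(_ 0 0)].
  rewrite summxE [RHS]mxE => E; split=> //; apply: etrans E.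
  by apply: eq_bigr => i _; rewrite !mxE mulr1.
pose P i := 0 < w 0 i; pose S := \sum_(i | P i) w 0 i.
have S' : \sum_(i | ~~ P i) - w 0 i = S.
  rewrite sumrN; apply/eqP; move/eqP: w1.
  by rewrite (bigID P) /= addr_eq0 -/S eq_sym.
have S0 : 0 < S.
  rewrite lt0r; apply/andP; split; last by apply: sumr_ge0 => i /ltW.
  apply: contra wn0 => /eqP S0; apply/eqP/rowP => i; rewrite mxE.
  have [Pi|Pi] := boolP (P i).
    have := Pi; rewrite /P lt0r => /andP[/negP[]].
    by move/eqP: S0; rewrite psumr_eq0 => [/allP /(_ i (mem_index_enum _))|j /ltW//]; rewrite Pi.
  move: S'; rewrite S0 => /eqP; rewrite psumr_eq0 => [/allP /(_ i (mem_index_enum _))|j].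
    by rewrite Pi /= oppr_eq0 => /eqP.
  by rewrite oppr_ge0 leNgt.
exists P, (S^-1 *: \sum_(i | P i) w 0 i *: y i); split.
  exists (fun i => if P i then w 0 i / S else 0); split.
  - by move=> i; case: ifP => // /ltW wi; rewrite divr_ge0 // ltW.
  - by move=> i /negbTE ->.
  - by rewrite -big_mkcond -mulr_suml divff // gt_eqF.
  - rewrite scaler_sumr big_mkcond; apply: eq_bigr => i _.
    by case: ifP => _; rewrite ?scale0r // scalerA mulrC.
exists (fun i => if P i then 0 else - w 0 i / S); split.
- move=> i; case: ifP => // /negbT; rewrite -leNgt => wi.
  by rewrite divr_ge0 ?oppr_ge0 // ltW.
- by move=> i /=; rewrite negbK => ->.
- rewrite -[RHS](divff (lt0r_neq0 S0)) -{2}S' mulr_suml [RHS]big_mkcond /=.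
  by apply: eq_bigr => i _; case: ifP.
- have -> : \sum_(i | P i) w 0 i *: y i = \sum_(i | ~~ P i) - w 0 i *: y i.
    apply/eqP; rewrite -subr_eq0; apply/eqP; rewrite -[RHS]wy [in RHS](bigID P) /=.
    by congr (_ + _); rewrite -sumrN; apply: eq_bigr => i _; rewrite scaleNr opprK.
  rewrite scaler_sumr big_mkcond; apply: eq_bigr => i _.
  by case: (P i); rewrite ?scale0r //= scalerA mulrC.
Qed.

Lemma helly_base (R : realType) D (C : 'I_D.+2 -> set 'rV[R]_D) :
  (forall i, convex (C i)) -> (forall i, exists y, forall j, j != i -> C j y) ->
  exists z, forall j, C j z.
Proof.
move=> cC /choice[y yP]; have [P [z [zP zP']]] := radon y.
exists z => j; have [Pj|Pj] := boolP (P j).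
  apply: hull_sub zP' => // i /= Pi; apply: yP.
  by apply: contraNneq Pi => <-.
by apply: hull_sub zP => // i Pi; apply: yP; apply: contraNneq Pj => ->.
Qed.

Fixpoint radon_tree D h : finType :=
  if h is h'.+1 then ('I_D.+2 * radon_tree D h')%type else unit.

Fixpoint bitstring h : finType :=
  if h is h'.+1 then (bool * bitstring h')%type else unit.

Lemma card_bitstring h : #|bitstring h| = (2 ^ h)%N.
Proof. by elim: h => [|h IH] /=; rewrite ?card_unit // card_prod card_bool IH expnS. Qed.

(** Induction supplies a common point for each of the [D.+2] blocks, and Radon is applied to these
    points. The label of a leaf records the side of its block, then its label inside the block, so
    (D + 2)^h points split into 2^h parts. *)
Lemma radon_iterated (R : realType) D h (y : radon_tree D h -> 'rV[R]_D) :
  exists (P : radon_tree D h -> bitstring h) z,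
  forall l, hull y (fun s => P s == l) z.
Proof.
elim: h y => [|h IH] y.
  exists (fun=> tt), (y tt) => l; apply: hull_mem; by case: l.
have /choice[Q HQ] : forall i : 'I_D.+2, exists Pz : (radon_tree D h -> bitstring h) * 'rV[R]_D,
    forall l, hull (fun s => y (i, s)) (fun s => Pz.1 s == l) Pz.2.
  by move=> i; have [P [z H]] := IH (fun s => y (i, s)); exists (P, z).
have [P [z [zP zP']]] := radon (fun i => (Q i).2).
exists (fun s : radon_tree D h.+1 => (P s.1, (Q s.1).1 s.2)), z => -[b l].
have sub (P' : pred 'I_D.+2) : (forall i, P' i -> P i = b) ->
    hull (fun i => (Q i).2) P' `<=` hull y (fun s => (P s.1, (Q s.1).1 s.2) == (b, l)).
  move=> PP'; apply: hull_sub => [|i /PP' Pi]; first exact: convex_hull.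
  apply: hull_sub (HQ i l) => [|s /eqP sl]; first exact: convex_hull.
  by apply: (@hull_mem _ _ _ y _ (i, s)); rewrite /= Pi sl.
by case: b sub => sub; [apply: sub zP|apply: sub zP' => i /= /negbTE].
Qed.

Lemma tverberg (R : realType) D : exists S : finType, forall y : S -> 'rV[R]_D,
  exists (P : S -> 'I_D.+1) z, forall l, hull y (fun s => P s == l) z.
Proof.
exists (radon_tree D D.+1) => y; have [P [z H]] := radon_iterated y.
have le : (D.+1 <= #|[pred l : bitstring D.+1 | true]|)%N.
  by rewrite cardE -cardT card_bitstring ltnW // ltn_expl.
have [g ginj _] := card_injection le.
(* Of the 2^(D + 1) labels only D + 1 are kept; the remaining parts are merged into [ord0], which
   only enlarges a hull. *)
exists (fun s => odflt ord0 [pick k | g k == P s]), z => l.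
apply: hull_le (H (g l)) => s /eqP gs; case: pickP => [k|/(_ l)] /=; rewrite gs.
  by move/eqP/ginj ->.
by rewrite eqxx.
Qed.


(** * Points of least norm and the exchange of blocks *)

Definition normsq (R : realType) D (x : 'rV[R]_D) : R := \sum_i x 0 i ^+ 2.

Lemma continuous_normsq (R : realType) D : continuous (@normsq R D).
Proof.
rewrite /normsq; elim: (index_enum _) => [|i r IH].
  have -> : (fun x : 'rV[R]_D => \sum_(i <- [::]) x 0 i ^+ 2) = cst 0.
    by apply: funext => w; rewrite big_nil.
  exact: cst_continuous.
have -> : (fun x : 'rV[R]_D => \sum_(j <- i :: r) x 0 j ^+ 2) =
    (fun x => x 0 i ^+ 2 + \sum_(j <- r) x 0 j ^+ 2).
  by apply: funext => w; rewrite big_cons.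
move=> w; apply: (@cvgD _ R^o _ _ (nbhs_filter (w : 'rV[R]_D)) (fun x : 'rV[R]_D => x 0 i ^+ 2)
  (fun x : 'rV[R]_D => \sum_(j <- r) x 0 j ^+ 2)); last exact: IH.
have h : {for w, continuous (fun x : 'rV[R]_D => x 0 i)} by apply: coord_continuous.
rewrite expr2; under eq_fun do rewrite expr2; exact: (continuousM h h).
Qed.

Lemma normsq_combination (R : realType) D (x y : 'rV[R]_D) t :
  normsq (t *: x + (1 - t) *: y)
  = t * normsq x + (1 - t) * normsq y - t * (1 - t) * normsq (x - y).
Proof.
rewrite /normsq !mulr_sumr -big_split /= -sumrB; apply: eq_bigr => i _.
by rewrite !mxE; ring.
Qed.

Lemma normsq_ge0 (R : realType) D (x : 'rV[R]_D) : 0 <= normsq x.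
Proof. by apply: sumr_ge0 => i _; apply: sqr_ge0. Qed.

Lemma normsq_eq0 (R : realType) D (x : 'rV[R]_D) : normsq x = 0 -> x = 0.
Proof.
move/eqP; rewrite psumr_eq0 => [/allP H|i _]; last exact: sqr_ge0.
apply/rowP => i; rewrite mxE; apply/eqP.
by have := H i (mem_index_enum _); rewrite /= expf_eq0.
Qed.

Lemma convex_ball_normsq (R : realType) D (r : R) : convex [set x : 'rV[R]_D | normsq x < r].
Proof.
move=> x y t /= xr yr /andP[t0 t1]; rewrite normsq_combination.
have := normsq_ge0 (x - y); set n := normsq (x - y) => n0.
have : 0 <= t * (1 - t) * n by rewrite !mulr_ge0 // subr_ge0.
have [->|tn0] := eqVneq t 0; first by move=> _; rewrite !mul0r !subr0 mul1r add0r.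
have : t * normsq x < t * r by rewrite ltr_pM2l // lt0r tn0.
have : (1 - t) * normsq y <= (1 - t) * r by rewrite ler_wpM2l ?subr_ge0 // ltW.
lra.
Qed.

Lemma min_norm_exists (R : realType) D (K : set 'rV[R]_D) : compact K -> (exists x, K x) ->
  exists p, K p /\ forall q, K q -> normsq p <= normsq q.
Proof.
move=> cK nK; have [|c] := compact_EVT_min (A := K) (f := @normsq R D) nK cK.
  exact/continuous_subspaceT/continuous_normsq.
by rewrite inE => Kc H; exists c; split=> // q Kq; apply: H; rewrite inE.
Qed.

Lemma min_norm_unique (R : realType) D (K : set 'rV[R]_D) p q : convex K ->
  K p -> (forall x, K x -> normsq p <= normsq x) -> K q -> normsq q <= normsq p -> q = p.
Proof.
move=> cK Kp pmin Kq qp.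
have h : 0 <= 2^-1 :> R by rewrite invr_ge0.
have h1 : 2^-1 <= 1 :> R by lra.
have := pmin _ (cK _ _ 2^-1 Kq Kp _); rewrite h h1 normsq_combination => /(_ isT) H.
apply/eqP; rewrite -subr_eq0; apply/eqP; apply: normsq_eq0; apply: le_anti.
by rewrite normsq_ge0 andbT; lra.
Qed.

(* Katchalski-Liu: the point of least norm of an intersection of [D + 1] compact
   convex sets is already determined by [D] of them; exchanging the block of
   coordinates governing the remaining set shows that this point lies in many sets. *)
Lemma block_katchalski_liu (R : realType) D (S A : finType) (P : S -> 'I_D.+1)
    (C : 'I_D.+1 -> {ffun S -> A} -> set 'rV[R]_D) (w : A -> R) (alpha : R) :
  let mu (b : {ffun S -> A}) := \prod_s w (b s) in
  let good b := exists z, forall l, C l b z in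
  (0 < D)%N -> (forall l b, convex (C l b)) ->
  (forall l (b b' : {ffun S -> A}), (forall s, P s = l -> b s = b' s) -> C l b = C l b') ->
  (forall a, 0 <= w a) -> 0 < alpha * \sum_b mu b ->
  alpha * \sum_b mu b <= \sum_(b | `[< good b >]) mu b ->
  exists l z, alpha * \sum_b mu b <= D.+2%:R * \sum_(b | `[< C l b z >]) mu b.
Proof.
move=> mu good D0 cC Cdep w0; set W := \sum_b mu b => aW0 aW.
have mu0 b : 0 <= mu b by apply: prodr_ge0.
have /choice[x xP] : forall b, exists z, good b -> forall l, C l b z.
  by move=> b; have [[z Hz]|nb] := pselect (good b); [exists z|exists 0].
(* Finitely many witnesses replace each set by a compact subset. It depends on [C l b] only, hence
   still on block [l] of [b] only. *)
pose C' l b := hull x (fun b' => `[< good b' >] && `[< C l b (x b') >]).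
have C'C l b : C' l b `<=` C l b.
  by apply: hull_sub => // b' /andP[_ /asboolP].
have C'x b : good b -> forall l, C' l b (x b).
  by move=> gb l; apply: hull_mem; rewrite !asboolT //; apply: xP.
have cC' l b : convex (C' l b) by apply: convex_hull.
have C'dep l (b b' : {ffun S -> A}) : (forall s, P s = l -> b s = b' s) -> C' l b = C' l b'.
  by move=> /Cdep E; rewrite /C' E.
pose M k b := [set z | forall l, l != k -> C' l b z].
have cM k b : convex (M k b).
  by move=> z z' t Mz Mz' t01 l lk; apply: cC' => //; [apply: Mz|apply: Mz'].
have closedC' l b : closed (C' l b).
  by apply: compact_closed; [exact: norm_hausdorff|exact: compact_hull].
have compactI (Q : pred 'I_D.+1) b : (exists l, Q l) ->
    compact [set z | forall l, Q l -> C' l b z].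
  move=> [l0 Ql0]; apply: (@subclosed_compact _ _ (C' l0 b)).
  - have -> : [set z | forall l, Q l -> C' l b z] = \bigcap_(l in [set l | Q l]) C' l b.
      by apply/seteqP; split=> z /= H l; apply: H.
    by apply: closed_bigI => l _; apply: closedC'.
  - exact: compact_hull.
  - by move=> z; apply.
pose least k b := [set z | M k b z /\ forall q, M k b q -> normsq z <= normsq q].
(* This point ignores block [k] of [b]. The default 0 is taken when there is no least point. *)
pose p k b := xget 0 (least k b).
have works b : good b -> exists k, C k b (p k b).
  move=> gb.
  have [|p0 [p0M p0min]] := min_norm_exists (compactI xpredT b (ex_intro _ ord0 isT)).
    by exists (x b) => l _; apply: C'x.
  have [k Hk] : exists k, forall q, M k b q -> normsq p0 <= normsq q.
    apply: contrapT => /forallNP H.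
    (* If omitting any one set made a smaller norm possible, the open ball and the [D.+1] sets would
       satisfy the hypothesis of Helly for [D.+2] sets, and a common point would beat [p0]. *)
    pose C2 := fcons [set z | normsq z < normsq p0] (fun l => C' l b).
    have [||z Hz] := @helly_base _ _ C2.
    - move=> i; case: (unliftP ord0 i) => [l|] ->; rewrite /C2 ?fconsS ?fcons0 //.
      exact: convex_ball_normsq.
    - move=> i; case: (unliftP ord0 i) => [l|] ->.
        have /existsNP[q /not_implyP[Mq /negP qp]] := H l.
        exists q => j; case: (unliftP ord0 j) => [m|] ->; rewrite /C2 ?fconsS ?fcons0.
          by move=> ml; apply: Mq; apply: contraNneq ml => ->.
        by rewrite /= ltNge.
      exists p0 => j; case: (unliftP ord0 j) => [m|] ->; last by rewrite eqxx.
      by move=> _; rewrite /C2 fconsS; apply: p0M.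
    have z0 := Hz ord0; rewrite /C2 fcons0 /= in z0.
    have : normsq p0 <= normsq z.
      by apply: p0min => l _; have := Hz (lift ord0 l); rewrite /C2 fconsS.
    by rewrite leNgt z0.
  exists k; have p0M' : M k b p0 by move=> l _; apply: p0M.
  have : least k b (p k b).
    by rewrite /p; case: xgetP => [_ -> //|/(_ p0)]; case; split.
  move=> [pM pmin]; apply: C'C; suff -> : p k b = p0 by apply: p0M.
  by apply: (min_norm_unique (cM k b)) => //; apply: pmin.
apply: contrapT => /forallNP H.
have {}H l z : \sum_(b | `[< C l b z >]) mu b <= alpha * W / D.+2%:R.
  rewrite ler_pdivlMr ?ltr0n // mulrC leNgt; apply/negP => /ltW h.
  by apply: (H l); exists z.
pose mix k (b c : {ffun S -> A}) := [ffun s => if P s == k then c s else b s].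
have mixp k b c : p k (mix k b c) = p k b.
  rewrite /p; congr (xget 0 _); rewrite /least.
  suff -> : M k (mix k b c) = M k b by [].
  apply/seteqP; split=> z Mz l lk; have := Mz l lk.
    by rewrite (C'dep l (mix k b c) b) // => s sl; rewrite ffunE sl (negbTE lk).
  by rewrite (C'dep l (mix k b c) b) // => s sl; rewrite ffunE sl (negbTE lk).
have mixC k b c : C k (mix k b c) = C k c.
  by apply: Cdep => s sk; rewrite ffunE sk eqxx.
have W0 : 0 < W.
  have W0' : 0 <= W by apply: sumr_ge0.
  by rewrite lt0r W0' andbT; apply: contraTneq aW0 => ->; rewrite mulr0 ltxx.
have Sk k : \sum_(b | `[< C k b (p k b) >]) mu b <= alpha * W / D.+2%:R.
  rewrite -(ler_pM2r W0).
  have -> : (\sum_(b | `[< C k b (p k b) >]) mu b) * W = \sum_b \sum_c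
      (if `[< C k b (p k b) >] then mu b * mu c else 0).
    rewrite big_mkcond mulr_suml; apply: eq_bigr => b _.
    by case: ifP => _; [rewrite mulr_sumr|rewrite mul0r big1].
  rewrite pair_bigA /=.
  (* Exchanging block [k] between two independent tuples preserves the product weight and turns
     [C k b (p k b)] into [C k c (p k b)]. For fixed [b] the latter concerns a fixed point, to which
     the assumed bound [H] applies. *)
  have swK : involutive (fun bc : {ffun S -> A} * {ffun S -> A} =>
      (mix k bc.1 bc.2, mix k bc.2 bc.1)).
    by move=> [b c] /=; congr (_, _); apply/ffunP => s; rewrite !ffunE; case: (P s == k).
  rewrite (reindex_inj (inv_inj swK)) /=.
  have -> : \sum_(bc : {ffun S -> A} * {ffun S -> A})
        (if `[< C k (mix k bc.1 bc.2) (p k (mix k bc.1 bc.2)) >]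
         then mu (mix k bc.1 bc.2) * mu (mix k bc.2 bc.1) else 0)
      = \sum_b \sum_c (if `[< C k c (p k b) >] then mu b * mu c else 0).
    rewrite pair_bigA; apply: eq_bigr => -[b c] _ /=; rewrite mixp mixC.
    case: ifP => // _; rewrite /mu -!big_split /=; apply: eq_bigr => s _.
    by rewrite !ffunE; case: ifP => _ //; rewrite mulrC.
  rewrite [leRHS]mulrC /W mulr_suml; apply: ler_sum => b _.
  by rewrite -big_mkcond -mulr_sumr ler_wpM2l.
(* Every good tuple is counted for some [k], yet [D.+1] terms of at most [alpha * W / D.+2] fall
   short of [alpha * W]. *)
have : alpha * W <= \sum_k \sum_(b | `[< C k b (p k b) >]) mu b.
  apply: le_trans aW _; rewrite (exchange_big_dep xpredT) //= big_mkcond.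
  apply: ler_sum => b _; case: ifP => [/asboolP/works[k Hk]|_].
    by rewrite (bigD1 k) ?asboolT //= lerDl sumr_ge0.
  by apply: sumr_ge0.
have : \sum_(k < D.+1) \sum_(b | `[< C k b (p k b) >]) mu b
    <= \sum_(k < D.+1) alpha * W / D.+2%:R by apply: ler_sum.
rewrite sumr_const card_ord -[_ *+ D.+1]mulr_natl => h1 h2.
have := le_trans h2 h1; rewrite mulrCA ler_pMr // ler_pdivlMr ?ltr0n // mul1r.
by rewrite ler_nat ltnn.
Qed.

(** * Piercing by few points *)

Lemma weighted_pigeonhole (R : realType) (B F : finType) (f : B -> F) (mu : B -> R) :
  (0 < #|F|)%N -> exists c, \sum_b mu b <= #|F|%:R * \sum_(b | f b == c) mu b.
Proof.
move=> F0; apply: contrapT => /forallNP H.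
have : \sum_(c : F) (#|F|%:R * \sum_(b | f b == c) mu b) < \sum_(c : F) \sum_b mu b.
  have /card_gt0P[c0 _] := F0.
  have lt c : #|F|%:R * \sum_(b | f b == c) mu b < \sum_b mu b.
    by rewrite ltNge; apply/negP/H.
  rewrite (bigD1 c0) //= [ltRHS](bigD1 c0) //=.
  by apply: ltr_leD => //; apply: ler_sum => c _; apply/ltW/lt.
rewrite -mulr_sumr sumr_const -[_ *+ #|_|]mulr_natl.
by rewrite [X in _ < _ * X](partition_big f xpredT) //= ltxx.
Qed.

Lemma hull_eq_in (R : realType) (I : finType) D (y y' : I -> 'rV[R]_D) (P : pred I) :
  (forall i, P i -> y i = y' i) -> hull y P = hull y' P.
Proof.
move=> E; apply/seteqP; split; apply: hull_sub; try exact: convex_hull.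
  by move=> i Pi; rewrite E //; apply: hull_mem.
by move=> i Pi; rewrite -E //; apply: hull_mem.
Qed.

(** The first selection lemma, for tuples with repetitions. The most frequent Tverberg partition
    [P0] serves a fixed share of the tuples, and its parts are the blocks of [block_katchalski_liu].
    The resulting point lies in the hull of one part, hence in the hull of the tuple. *)
Lemma selection (R : realType) D : (0 < D)%N -> exists (S : finType) (q : nat),
  forall (A : finType) (y : A -> 'rV[R]_D), (0 < #|A|)%N -> exists z,
  (#|{ffun S -> A}| <= q * #|[pred c : {ffun S -> A} | `[< hull (y \o c) xpredT z >]]|)%N.
Proof.
move=> D0; have [S HS] := tverberg R D.
pose F : finType := {ffun S -> 'I_D.+1}.
have F0 : (0 < #|F|)%N by apply/card_gt0P; exists [ffun=> ord0].
exists S, (#|F| * D.+2)%N => A y A0.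
have /choice[f fP] : forall b : {ffun S -> A}, exists P : F,
    exists z, forall l, hull (y \o b) (fun s => P s == l) z.
  move=> b; have [P [z Hz]] := HS (y \o b); exists (finfun P), z => l.
  by apply: hull_le (Hz l) => s; rewrite ffunE.
have [P0] := weighted_pigeonhole f (fun=> 1 : R) F0.
rewrite !sumr_const => H.
pose C l (b : {ffun S -> A}) := hull (y \o b) (fun s => P0 s == l).
have muE (b : {ffun S -> A}) : \prod_s (fun=> 1 : R) (b s) = 1 by rewrite big1.
have cardB : \sum_(b : {ffun S -> A}) \prod_s (fun=> 1 : R) (b s) = #|{ffun S -> A}|%:R.
  transitivity (\sum_(b : {ffun S -> A}) (1 : R)); last by rewrite sumr_const.
  by apply: eq_bigr => b _; apply: muE.
have B0 : (0 < #|{ffun S -> A}|)%N.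
  by have /card_gt0P[a _] := A0; apply/card_gt0P; exists [ffun=> a].
have [|||||l [z Hz]] := @block_katchalski_liu R D S A P0 C (fun=> 1) (#|F|%:R^-1) D0.
- by move=> l b; apply: convex_hull.
- by move=> l b b' bb'; apply: hull_eq_in => s /eqP sl; rewrite /= bb'.
- by move=> a; apply: ler01.
- by rewrite cardB mulr_gt0 // ?invr_gt0 ltr0n.
- rewrite cardB ler_pdivrMl ?ltr0n //; apply: le_trans H _.
  rewrite ler_wpM2l // (eq_bigr _ (fun b _ => muE b)) sumr_const.
  rewrite ler_nat; apply: subset_leq_card; apply/fintype.subsetP => b.
  rewrite !unfold_in => fb0; have fb : f b = P0 by apply/eqP.
  apply/asboolP; have [z Hz] := fP b.
  by exists z => l; rewrite /C -fb.
exists z; move: Hz; rewrite cardB ler_pdivrMl ?ltr0n //.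
rewrite (eq_bigr _ (fun b _ => muE b)) sumr_const -!natrM ler_nat mulnA => /leq_trans; apply.
rewrite leq_mul2l; apply/orP; right; apply: subset_leq_card.
apply/fintype.subsetP => b; rewrite !unfold_in => /asboolP Hb.
by apply/asboolP; apply: hull_le Hb.
Qed.

(** For x = 1/(2m), Bernoulli gives (1 + x)^(6m) >= 1 + 3 = 4, while (1 - x)(1 + x) <= 1. *)
Lemma geometric_decay (R : realType) (m : nat) : (0 < m)%N ->
  (1 - (2 * m)%:R^-1 : R) ^+ (6 * m) <= 4^-1.
Proof.
move=> m0; set x : R := _^-1.
have x0 : 0 < x by rewrite invr_gt0 ltr0n muln_gt0.
have x1 : x <= 1 by rewrite invf_le1 ?ltr0n ?muln_gt0 // ler1n muln_gt0.
have bern n : 1 + n%:R * x <= (1 + x) ^+ n.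
  elim: n => [|n IH]; first by rewrite mul0r addr0.
  rewrite exprS; apply: le_trans (ler_wpM2l _ IH); last by rewrite addr_ge0 // ltW.
  rewrite -natr1; have : 0 <= n%:R * x * x by rewrite !mulr_ge0 // ltW.
  by lra.
have H : (1 - x) ^+ (6 * m) * (1 + x) ^+ (6 * m) <= 1.
  rewrite -exprMn; apply: exprn_ile1; first by rewrite mulr_ge0 ?subr_ge0 // addr_ge0 // ltW.
  have : 0 <= x * x by rewrite mulr_ge0 // ltW.
  by lra.
have x3 : (6 * m)%:R * x = 3.
  have -> : (6 * m)%N = (3 * (2 * m))%N by lia.
  by rewrite natrM -mulrA /x divff ?mulr1 // pnatr_eq0 -lt0n muln_gt0.
have := bern (6 * m)%N; rewrite x3 => H4.
rewrite -[leRHS]mul1r ler_pdivlMr ?ltr0n //.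
apply: le_trans H; apply: ler_wpM2l; last by lra.
by rewrite exprn_ge0 // subr_ge0.
Qed.

(* Multiplicative weights: every time a point is chosen, the sets containing it
   lose half of their weight. *)
Lemma multiplicative_weights (R : realType) (V : Type) (I : finType) (G : I -> set V)
    (m : nat) : (0 < m)%N ->
  (forall w : I -> R, (forall i, 0 <= w i) ->
    exists z, \sum_i w i <= m%:R * \sum_(i | `[< G i z >]) w i) ->
  exists T (y : 'I_T -> V), (0 < T)%N /\
    forall i, (T <= 6 * m * #|[pred t | `[< G i (y t) >]]|)%N.
Proof.
move=> m0 deep; pose x : R := (2 * m)%:R^-1.
have x0 : 0 < x by rewrite invr_gt0 ltr0n muln_gt0.
have x1 : x <= 1 by rewrite invf_le1 ?ltr0n ?muln_gt0 // ler1n muln_gt0.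
pose cnt ys i := count (fun z => `[< G i z >]) ys.
have run T : exists ys : seq V, size ys = T /\
    \sum_i (2^-1 : R) ^+ cnt ys i <= #|I|%:R * (1 - x) ^+ T.
  elim: T => [|T [ys [szT IH]]].
    exists [::]; split=> //; rewrite mulr1 (eq_bigr (fun=> 1)) // sumr_const.
    by rewrite -[leLHS]mulr_natr mul1r.
  have [|z Hz] := deep (fun i => 2^-1 ^+ cnt ys i).
    by move=> i; rewrite exprn_ge0 // invr_ge0.
  exists (z :: ys); split; first by rewrite /= szT.
  rewrite exprSr mulrA; apply: le_trans (ler_wpM2r _ IH); last by rewrite subr_ge0.
  set W := \sum_i _ in Hz *; set Wz := \sum_(i | _) _ in Hz.
  have -> : \sum_i 2^-1 ^+ cnt (z :: ys) i = W - 2^-1 * Wz.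
    rewrite /W /Wz [X in _ = _ - _ * X]big_mkcond mulr_sumr -sumrB; apply: eq_bigr => i _.
    rewrite /cnt /=; case: asboolP => _; rewrite ?add0n ?mulr0 ?subr0 // add1n exprS.
    by field.
  have : W * x <= 2^-1 * Wz.
    rewrite ler_pdivrMr ?ltr0n ?muln_gt0 // natrM.
    by apply: le_trans Hz _; lra.
  lra.
(* After 6mk rounds the total weight is at most #|I| 4^-k <= 2^-k, so each set has been halved at
   least [k] times, a share 1/(6m) of the rounds. *)
pose k := #|I|.+1.
have [ys [szT H]] := run (6 * m * k)%N.
exists (6 * m * k)%N, (fun t => tnth (Tuple (introT eqP szT)) t); split.
  by rewrite !muln_gt0 m0.
move=> i; rewrite leq_mul2l; apply/orP; right.
have -> : #|[pred t | `[< G i (tnth (Tuple (introT eqP szT)) t) >]]| = cnt ys i.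
  rewrite /cnt -[ys in RHS]/(tval (Tuple (introT eqP szT))).
  set tt := Tuple _; rewrite -[tval tt in RHS](map_tnth_enum tt) count_map.
  by rewrite -sum1_card -sum1_count big_enum_cond; apply: eq_bigl => t; rewrite unfold_in.
have Ik : (#|I|%:R : R) <= 2 ^+ k.
  by rewrite -natrX ler_nat (leq_trans (ltnW (ltnSn _))) // ltnW // ltn_expl.
have : (2^-1 : R) ^+ cnt ys i <= 2^-1 ^+ k.
  have : (2^-1 : R) ^+ cnt ys i <= \sum_i (2^-1 : R) ^+ cnt ys i.
    by rewrite [leRHS](bigD1 i) //= lerDl sumr_ge0 // => j _; rewrite exprn_ge0 // invr_ge0.
  move=> /le_trans; apply; apply: le_trans H _.
  rewrite exprM; apply: le_trans (_ : 2 ^+ k * 4^-1 ^+ k <= _); last first.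
    by rewrite -exprMn; rewrite lerXn2r // ?nnegrE; lra.
  apply: ler_pM => //; first by rewrite exprn_ge0 // exprn_ge0 // subr_ge0.
  by rewrite lerXn2r ?nnegrE ?exprn_ge0 ?subr_ge0 ?invr_ge0 // geometric_decay.
by rewrite !exprVn lef_pV2 ?posrE ?exprn_gt0 // ler_eXn2l // ltr1n.
Qed.

(* Greedy: a point of a set not yet pierced, chosen in the hulls of a positive
   proportion of the tuples drawn from that set, can be repeated only boundedly often. *)
Lemma weak_net (R : realType) D (m : nat) : (0 < D)%N -> exists r : nat,
  forall (I : finType) (G : I -> set 'rV[R]_D) T (y : 'I_T -> 'rV[R]_D),
  (forall i, convex (G i)) -> (0 < T)%N ->
  (forall i, (T <= m * #|[pred t | `[< G i (y t) >]]|)%N) ->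
  exists2 Z : seq 'rV[R]_D, (size Z <= r)%N & forall i, exists2 z, z \in Z & G i z.
Proof.
move=> D0; have [S [q sel]] := selection R D0.
(* A set holding a share 1/m of the points holds a share m^-#|S| of the tuples, and [selection]
   kills 1/q of these. More than [Q] rounds would kill more tuples than there are. *)
pose Q := (q * m ^ #|S|)%N.
exists Q.+1 => I G T y cG T0 dense.
pose killed (Z : seq 'rV[R]_D) :=
  [pred c : {ffun S -> 'I_T} | `[< exists2 z, z \in Z & hull (y \o c) xpredT z >]].
pose hits (Z : seq 'rV[R]_D) := forall i, exists2 z, z \in Z & G i z.
have greedy k : exists2 Z : seq 'rV[R]_D, (size Z <= k)%N &
    hits Z \/ (k * T ^ #|S| <= Q * #|killed Z|)%N.
  elim: k => [|k [Z szZ [hZ|kZ]]]; first by exists [::] => //; right; rewrite mul0n.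
    by exists Z; [apply: leqW|left].
  have [hZ|] := pselect (hits Z); first by exists Z; [apply: leqW|left].
  move=> /existsNP[i nhit].
  pose A : finType := {t : 'I_T | `[< G i (y t) >]}.
  have cA : #|A| = #|[pred t | `[< G i (y t) >]]| by rewrite card_sig; apply: eq_card.
  have A0 : (0 < #|A|)%N.
    by have := dense i; rewrite -cA; case: #|A| => //; rewrite muln0 leqn0 => /eqP T00; rewrite T00 in T0.
  have [z Hz] := sel A (y \o val) A0.
  set N := [pred c | _] in Hz.
  exists (z :: Z); first by rewrite ltnS.
  right; pose emb (c : {ffun S -> A}) : {ffun S -> 'I_T} := [ffun s => val (c s)].
  have emb_inj : injective emb.
    by move=> c c' /ffunP E; apply/ffunP => s; apply: val_inj; have := E s; rewrite !ffunE.
  have embE (c : {ffun S -> A}) : y \o emb c =1 (y \o val) \o c.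
    by move=> s; rewrite /= ffunE.
  have cN : #|image_mem emb (mem N)| = #|N| by apply: fintype.card_image.
  (* An earlier point in the hull of a tuple drawn from [G i] would lie in [G i] by convexity, but
     [G i] is not yet hit. *)
  have disj : #|[predI killed Z & image_mem emb (mem N)]| = 0%N.
    apply: eq_card0 => c; rewrite !inE; apply/negP => /andP[/asboolP[x xZ xc]].
    move=> /mapP[c' _ cc']; apply: nhit; exists x => //.
    move: x xc {xZ}; apply: hull_sub => // s _; rewrite cc' embE /=.
    by apply/asboolP/(valP (c' s)).
  have sub : (#|[predU killed Z & image_mem emb (mem N)]| <= #|killed (z :: Z)|)%N.
    apply: subset_leq_card; apply/fintype.subsetP => c.
    rewrite !inE => /orP[].
      by move=> /asboolP[x xZ xc]; exists x => //; rewrite inE xZ orbT.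
    move=> /mapP[c']; rewrite mem_enum unfold_in => /asboolP Hc -> {c}.
    exists z; first exact: mem_head.
    by rewrite (@hull_eq_in _ _ _ _ ((y \o val) \o c')) // => s _; rewrite embE.
  have UI := cardUI (mem (killed Z)) (mem (image_mem emb (mem N))).
  rewrite disj addn0 cN in UI; rewrite UI in sub.
  apply: leq_trans (_ : Q * (#|killed Z| + #|N|) <= _)%N; last by rewrite leq_mul2l sub orbT.
  rewrite mulSn mulnDr addnC; apply: leq_add => //.
  apply: leq_trans (_ : (m * #|A|) ^ #|S| <= _)%N; last first.
    rewrite expnMn /Q mulnAC [(_ * m ^ _)%N]mulnC leq_mul2l; apply/orP; right.
    by rewrite card_ffun in Hz.
  by rewrite cA; case: #|S| => // e; rewrite leq_exp2r.
have [Z szZ [hZ|kZ]] := greedy Q.+1; first by exists Z.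
have : (#|killed Z| <= T ^ #|S|)%N.
  by apply: leq_trans (max_card _) _; rewrite card_ffun card_ord.
have : (0 < T ^ #|S|)%N by rewrite expn_gt0 T0.
move: kZ; set a := (T ^ _)%N; set b := #|_| => kZ a0 ba.
have : (Q * b <= Q * a)%N by rewrite leq_mul2l ba orbT.
by move: kZ; rewrite mulSn => kZ /(leq_trans kZ); rewrite leqNgt -{1}[(Q * a)%N]add0n ltn_add2r a0.
Qed.

Lemma weighted_depth (R : realType) D (p : nat) : (0 < D)%N -> exists2 m : nat, (0 < m)%N &
  forall (I : finType) (G : I -> set 'rV[R]_D), (forall i, convex (G i)) ->
  (forall g : 'I_p -> I, exists2 e : 'I_D.+1 -> 'I_p, injective e &
     exists z, forall l, G (g (e l)) z) ->
  forall w : I -> R, (forall i, 0 <= w i) ->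
    exists z, \sum_i w i <= m%:R * \sum_(i | `[< G i z >]) w i.
Proof.
move=> D0; pose F : finType := {ffun 'I_D.+1 -> 'I_p}.
exists (#|F| * D.+2).+1 => // I G cG pq w w0.
pose W := \sum_i w i.
have : 0 <= W by apply: sumr_ge0.
rewrite le0r => /orP[/eqP W0|W0].
  by exists 0; rewrite -/W W0 mulr_ge0 // sumr_ge0.
have [i0 _] : exists i : I, true.
  apply: contrapT => /forallNP nI; move: W0; rewrite /W big1 ?ltxx // => i _.
  by case: (nI i).
pose mu (b : {ffun 'I_p -> I}) := \prod_s w (b s).
have /choice[f fP] : forall b : {ffun 'I_p -> I}, exists e : F, injective e /\
    exists z, forall l, G (b (e l)) z.
  move=> b; have [e ei [z Hz]] := pq b; exists (finfun e); split.
    by move=> l l'; rewrite !ffunE => /ei.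
  by exists z => l; rewrite ffunE.
have F0 : (0 < #|F|)%N by apply/card_gt0P; exists (f [ffun=> i0]).
have [e He] := weighted_pigeonhole f mu F0.
have muT : \sum_b mu b = \prod_(s < p) W by rewrite /W bigA_distr_bigA.
have muT0 : 0 < \sum_b mu b by rewrite muT prodr_gt0.
have ei : injective e.
  apply: contrapT => nei; move: He; rewrite [X in _ * X]big1 ?mulr0; first by rewrite leNgt muT0.
  by move=> b /eqP fb; case: nei; rewrite -fb; case: (fP b).
(* Each block contains its position [e l]; positions outside the range of [e] may join any block and
   are put into [ord0]. *)
pose P s := odflt ord0 [pick l | e l == s].
have PE l : P (e l) = l.
  rewrite /P; case: pickP => [l' /eqP/ei //|/(_ l)]; by rewrite eqxx.
have [|||||l [z Hz]] :=
  @block_katchalski_liu R D _ I P (fun l (b : {ffun 'I_p -> I}) => G (b (e l))) w (#|F|%:R^-1) D0.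
- by move=> l b; apply: cG.
- by move=> l b b' bb'; rewrite bb'.
- by [].
- by rewrite mulr_gt0 // invr_gt0 ltr0n.
- rewrite ler_pdivrMl ?ltr0n //; apply: le_trans He _.
  rewrite ler_wpM2l // big_mkcond [leRHS]big_mkcond; apply: ler_sum => b _.
  have mb0 : 0 <= mu b by apply: prodr_ge0.
  case: eqP => [fb|_]; last by case: ifP.
  case: asboolP => // -[]; have [_ [z Hz]] := fP b.
  by exists z => l; rewrite -fb.
exists z; move: Hz; rewrite ler_pdivrMl ?ltr0n // mulrA -natrM muT.
rewrite [X in _ <= _ * X](_ : _ =
    (\sum_(i | `[< G i z >]) w i) * \prod_(s < p | s != e l) W); last first.
  pose w' s i := if (s == e l) && ~~ `[< G i z >] then 0 else w i.
  transitivity (\sum_(b : {ffun 'I_p -> I}) \prod_s w' s (b s)).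
    rewrite big_mkcond; apply: eq_bigr => b _; case: asboolP => Gb.
      apply: eq_bigr => s _; rewrite /w'; case: eqP => // ->.
      by rewrite (introT (asboolP _) Gb).
    by rewrite (bigD1 (e l)) //= /w' eqxx (introF (asboolP _) Gb) mul0r.
  rewrite -bigA_distr_bigA (bigD1 (e l)) //=; congr (_ * _).
    rewrite [RHS]big_mkcond; apply: eq_bigr => i _; rewrite /w' eqxx.
    by case: asboolP.
  by apply: eq_bigr => s /negbTE sl; apply: eq_bigr => i _; rewrite /w' sl.
rewrite (bigD1 (e l)) //= mulrA ler_pM2r ?prodr_gt0 // => /le_trans; apply.
by apply: ler_wpM2r; rewrite ?sumr_ge0 // ler_nat.
Qed.

Lemma pq_theorem (R : realType) D (p : nat) : (0 < D)%N -> exists r : nat,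
  forall (I : finType) (G : I -> set 'rV[R]_D), (forall i, convex (G i)) ->
  (forall g : 'I_p -> I, exists2 e : 'I_D.+1 -> 'I_p, injective e &
     exists z, forall l, G (g (e l)) z) ->
  exists2 Z : seq 'rV[R]_D, (size Z <= r)%N & forall i, exists2 z, z \in Z & G i z.
Proof.
move=> D0; have [m m0 depth] := weighted_depth R p D0.
have [r net] := weak_net R (6 * m) D0.
exists r => I G cG pq.
have [T [y [T0 dense]]] := multiplicative_weights m0 (depth I G cG pq).
exact: net T0 dense.
Qed.

(** * Volume and triangular maps *)

Lemma box_vol_ge0 (R : realType) d (a b : 'rV[R]_d) : 0 <= box_vol a b.
Proof. by apply: prodr_ge0 => i _; rewrite le_max lexx. Qed.

Lemma vol_cover (R : realType) d (A : set 'rV[R]_d) (a b : nat -> 'rV[R]_d) :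
  A `<=` \bigcup_n box (a n) (b n) ->
  (vol A <= \sum_(0 <= n <oo) (box_vol (a n) (b n))%:E)%E.
Proof. by move=> AB; apply: ereal_inf_lbound; exists a, b. Qed.

Lemma vol_ge0 (R : realType) d (A : set 'rV[R]_d) : (0 <= vol A)%E.
Proof.
apply: le_ereal_inf_tmp => _ [a [b [_ ->]]].
by apply: nneseries_ge0 => n _ _; rewrite lee_fin box_vol_ge0.
Qed.

Lemma le_vol (R : realType) d (A B : set 'rV[R]_d) : A `<=` B -> (vol A <= vol B)%E.
Proof.
move=> AB; apply: ereal_inf_le_tmp => s [a [b [BC ->]]].
by exists a, b; split=> //; apply: subset_trans BC.
Qed.

Lemma vol_bigcup (R : realType) d (A : nat -> set 'rV[R]_d) :
  (vol (\bigcup_n A n) <= \sum_(0 <= n <oo) vol (A n))%E.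
Proof.
have [[i Ai]|/forallNP fin] := pselect (exists i, vol (A i) = +oo%E).
  rewrite (eseries_pinfty _ _ Ai) ?leey // => n _.
  by rewrite -ltNye (lt_le_trans _ (vol_ge0 _)).
apply/lee_addgt0Pr => e e0.
apply: le_trans (epsilon_trick xpredT _ (ltW e0)); last by move=> n; apply: vol_ge0.
have /choice[B HB] : forall n, exists B : (nat -> 'rV[R]_d) * (nat -> 'rV[R]_d),
    A n `<=` \bigcup_k box (B.1 k) (B.2 k) /\
    (\sum_(0 <= k <oo) (box_vol (B.1 k) (B.2 k))%:E
       <= vol (A n) + (e / (2 ^ n.+1)%:R)%:E)%E.
  move=> n; have en : 0 < e / (2 ^ n.+1)%:R by rewrite divr_gt0 // ltr0n expn_gt0.
  have Afin : vol (A n) \is a fin_num.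
    by rewrite ge0_fin_numE ?vol_ge0 // ltey; apply/eqP/fin.
  have [x [a [b [Aab ->]]] xlt] := lb_ereal_inf_adherent en Afin.
  by exists (a, b); split=> //; apply: ltW.
have /card_esym/ppcard_eqP[f] := card_nat2.
pose bv (ij : nat * nat) : \bar R := (box_vol ((B ij.1).1 ij.2) ((B ij.1).2 ij.2))%:E.
have bv0 ij : (0 <= bv ij)%E by rewrite lee_fin box_vol_ge0.
apply: le_trans (_ : \esum_(ij in [set: nat * nat]) bv ij <= _)%E.
  apply: le_trans (vol_cover (a := fun n => (B (f n).1).1 (f n).2)
                             (b := fun n => (B (f n).1).2 (f n).2) _) _.
    move=> x [i _ /(HB i).1[j _ xij]]; exists (f^-1%FUN (i, j)) => //=.
    by rewrite invK ?inE.
  rewrite nneseries_esumT; last by move=> n; rewrite lee_fin box_vol_ge0.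
  rewrite -[leLHS](@reindex_esum R _ _ setT setT f bv) //.
rewrite [leLHS](_ : _ = \sum_(0 <= i <oo) \sum_(0 <= j <oo) bv (i, j))%E.
  apply: lee_nneseries => [i _ _|i _]; first exact: nneseries_ge0.
  exact: (HB i).2.
rewrite nneseries_esumT; last by move=> i; apply: nneseries_ge0.
under [RHS]eq_esum do rewrite nneseries_esumT //.
rewrite (@esum_esum R nat nat setT (fun=> setT) (fun i j => bv (i, j))) //.
rewrite (_ : _ `*`` _ = setT); last by apply/seteqP; split.
by apply: eq_esum => -[].
Qed.

Lemma vol_finite_cover (R : realType) d n (A : set 'rV[R]_d) (a b : 'I_n -> 'rV[R]_d) :
  (0 < d)%N -> (forall x, A x -> exists i, box (a i) (b i) x) ->
  (vol A <= (\sum_i box_vol (a i) (b i))%:E)%E.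
Proof.
move=> d0 cov.
(* Padding with the box reduced to the origin costs nothing because [0 < d]; in dimension 0 its
   volume is an empty product, 1. *)
pose ext (c : 'I_n -> 'rV[R]_d) (k : nat) := if insub k is Some i then c i else 0.
have extE c (i : 'I_n) : ext c i = c i by rewrite /ext valK.
apply: le_trans (vol_cover (a := ext a) (b := ext b) _) _.
  by move=> x /cov[i xi]; exists (val i) => //; rewrite !extE.
rewrite (nneseries_split 0 n) => [|k _]; last by rewrite lee_fin box_vol_ge0.
rewrite eseries0 ?adde0 => [|k]; last first.
  rewrite add0n => nk _; rewrite /ext insubF ?ltnNge ?nk //.
  case: d d0 {A a b cov ext extE} => // d _.
  by rewrite /box_vol big_ord_recl mxE addrN maxxx mul0r.
rewrite add0n big_mkord sumEFin lee_fin.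
by apply: ler_sum => i _; rewrite !extE.
Qed.

Lemma vol_image (R : realType) d (f : 'rV[R]_d -> 'rV[R]_d) (k : R) : 0 < k ->
  (forall a b, (vol (f @` box a b) <= (k * box_vol a b)%:E)%E) ->
  forall A, (vol (f @` A) <= k%:E * vol A)%E.
Proof.
move=> k0 fbox A; rewrite -lee_pdivrMl //.
apply: le_ereal_inf_tmp => _ [a [b [AB ->]]]; rewrite lee_pdivrMl //.
apply: le_trans (_ : vol (\bigcup_n (f @` box (a n) (b n))) <= _)%E.
  by apply: le_vol => _ [x /AB[n _ xn] <-]; exists n => //; exists x.
apply: le_trans (vol_bigcup _) _.
rewrite -nneseriesZl; last by move=> n _; rewrite lee_fin box_vol_ge0.
by apply: lee_nneseries => [n _ _|n _]; [apply: vol_ge0|rewrite -EFinM].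
Qed.

(** The constant does not depend on [t]; taking [t = 1 / N] makes the error of a cover by [N] slabs
    tend to 0. *)
Lemma prod_perturbation (R : realType) (I : finType) (P : pred I) (c m : I -> R) :
  (forall i, 0 <= c i) -> (forall i, 0 <= m i) -> exists2 C, 0 <= C &
  forall t, 0 <= t <= 1 -> \prod_(i | P i) (c i + t * m i) <= \prod_(i | P i) c i + C * t.
Proof.
move=> c0 m0.
suff H : forall s : seq I, exists C, 0 <= C /\ forall t, 0 <= t <= 1 ->
    \prod_(i <- s) (c i + t * m i) <= \prod_(i <- s) c i + C * t.
  have [C [C0 HC]] := H [seq i <- index_enum I | P i].
  by exists C => // t /HC; rewrite !big_filter.
elim=> [|i s [C [C0 IH]]].
  by exists 0; split=> [//|t _]; rewrite !big_nil mul0r addr0.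
pose Q := \prod_(j <- s) c j; have Q0 : 0 <= Q by apply: prodr_ge0.
exists (c i * C + m i * (Q + C)); split.
  by rewrite addr_ge0 ?mulr_ge0 // addr_ge0.
move=> t t01; have /andP[t0 t1] := t01; rewrite !big_cons.
apply: le_trans (ler_wpM2l _ (IH t t01)) _; first by rewrite addr_ge0 // mulr_ge0.
rewrite -/Q [leRHS](_ : _ = c i * (Q + C * t) + t * m i * (Q + C)); last by ring.
rewrite mulrDl lerD2l; apply: ler_wpM2l; first by rewrite mulr_ge0.
by rewrite lerD2l ler_piMr.
Qed.

Lemma grid_cell (R : realType) (N : nat) (h t : R) : (0 < N)%N -> 0 <= t <= N%:R * h ->
  exists i : 'I_N, i%:R * h <= t <= i.+1%:R * h.
Proof.
elim: N => // N IH _ /andP[t0 tN].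
have [Nt|tN'] := leP (N%:R * h) t; first by exists ord_max; rewrite /= Nt tN.
case: N IH tN tN' => [|N] IH tN tN'.
  by move: (le_lt_trans t0 tN'); rewrite mul0r ltxx.
have [//||i Hi] := IH; first by rewrite t0 ltW.
by exists (widen_ord (leqnSn _) i).
Qed.

(** The elementary factors, a shear and a scaling at once, into which triangular matrices are
    decomposed. *)
Definition row_op (R : realType) d (w : 'rV[R]_d) (k : 'I_d) : 'M[R]_d :=
  \matrix_(i, j) if i == k then w 0 j else (i == j)%:R.

Lemma mul_row_op (R : realType) d (w u : 'rV[R]_d) (k j : 'I_d) :
  (u *m row_op w k) 0 j = u 0 k * w 0 j + (if j == k then 0 else u 0 j).
Proof.
rewrite mxE (bigD1 k) //= mxE eqxx; congr (_ + _).
case: eqP => [->|/eqP jk].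
  by rewrite big1 // => i /negbTE ik; rewrite mxE ik mulr0.
rewrite (bigD1 j) //= mxE (negbTE jk) eqxx mulr1 big1 ?addr0 // => i /andP[/negbTE ik].
by rewrite mxE ik => /negbTE ->; rewrite mulr0.
Qed.

(* Cutting the box into thin slabs orthogonal to the [k]-th axis makes the shear almost
   constant on each slab. *)
Lemma vol_row_op_box (R : realType) d (x w a b : 'rV[R]_d) (k : 'I_d) : 0 < w 0 k ->
  (vol ((fun u => x + u *m row_op w k)%R @` box a b) <= (w 0 k * box_vol a b)%:E)%E.
Proof.
move=> wk; have d0 : (0 < d)%N by apply: leq_ltn_trans (ltn_ord k).
have [[i bai]|/forallNP ab] := pselect (exists i, b 0 i < a 0 i).
  apply: le_trans (vol_finite_cover (n := 0) (a := fun=> 0) (b := fun=> 0) d0 _) _.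
    by move=> y [u /(_ i)/andP[/le_trans H /H]]; rewrite leNgt bai.
  by rewrite big_ord0 lee_fin mulr_ge0 ?box_vol_ge0 // ltW.
pose c j := b 0 j - a 0 j.
have c0 j : 0 <= c j by rewrite subr_ge0 leNgt; apply/negP/ab.
have bvE : box_vol a b = c k * \prod_(j | j != k) c j.
  transitivity (\prod_j c j); last by rewrite (bigD1 k).
  by apply: eq_bigr => j _; apply: max_r; apply: c0.
(* Within a slab of thickness [c k / N] the shear lengthens side [j] of the covering box by
   [m j / N]. *)
pose m j := 2 * c k * `|w 0 j|.
have m0 j : 0 <= m j by rewrite !mulr_ge0.
have [C C0 HC] := prod_perturbation (fun j => j != k) c0 m0.
apply/lee_addgt0Pr => e e0; set K := w 0 k * c k.
have K0 : 0 <= K by rewrite mulr_ge0 // ltW.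
have KC0 : 0 <= K * C / e by rewrite divr_ge0 ?mulr_ge0 // ltW.
pose N := (Num.bound (K * C / e)).+1.
pose h := c k / N%:R.
have h0 : 0 <= h by rewrite divr_ge0.
have Nh : N%:R * h = c k by rewrite /h mulrC divfK // pnatr_eq0.
pose lo (i : 'I_N) : 'rV[R]_d := \row_j (x 0 j + (a 0 k + i%:R * h) * w 0 j +
  if j == k then 0 else a 0 j - h * `|w 0 j|).
pose hi (i : 'I_N) : 'rV[R]_d := \row_j (x 0 j + (a 0 k + i%:R * h) * w 0 j +
  if j == k then h * w 0 k else b 0 j + h * `|w 0 j|).
apply: le_trans (vol_finite_cover (a := lo) (b := hi) d0 _) _.
  move=> y [u uab <-{y}].
  have [//||i /andP[iu ui]] := @grid_cell R N h (u 0 k - a 0 k).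
    have /andP[? ?] := uab k.
    by rewrite Nh /c subr_ge0; apply/andP; split => //; rewrite lerB.
  exists i => j; rewrite [lo i 0 j]mxE [hi i 0 j]mxE [(x + _) 0 j]mxE mul_row_op; set s := a 0 k + i%:R * h.
  have su : 0 <= u 0 k - s by rewrite /s; lra.
  have us : u 0 k - s <= h by move: ui; rewrite -natr1 mulrDl mul1r /s; lra.
  rewrite -!addrA !lerD2l; case: eqP => [->|_].
    have -> : u 0 k * w 0 k = s * w 0 k + (u 0 k - s) * w 0 k by ring.
    rewrite -!addrA !lerD2l !addr0; apply/andP; split; first by rewrite mulr_ge0 // ltW.
    by rewrite ler_wpM2r // ltW.
  have /andP[uj1 uj2] := uab j.
  have : `|(u 0 k - s) * w 0 j| <= h * `|w 0 j|.
    by rewrite normrM (ger0_norm su) ler_wpM2r.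
  rewrite ler_norml => /andP[H1 H2].
  by apply/andP; split; lra.
rewrite -EFinD lee_fin.
rewrite (eq_bigr (fun=> h * w 0 k * \prod_(j | j != k) (c j + N%:R^-1 * m j))); last first.
  move=> i _; rewrite /box_vol (bigD1 k) //=; congr (_ * _).
    rewrite !mxE eqxx addr0 [X in Num.max _ X](_ : _ = h * w 0 k); last by ring.
    by rewrite max_r // mulr_ge0 // ltW.
  apply: eq_bigr => j /negbTE jk; rewrite !mxE jk.
  rewrite [X in Num.max _ X](_ : _ = c j + N%:R^-1 * m j); last first.
    by rewrite /m /h /c; ring.
  by rewrite max_r // addr_ge0 // mulr_ge0.
rewrite sumr_const card_ord -[leLHS]mulr_natl mulrA [N%:R * (h * _)]mulrA Nh [c k * _]mulrC -/K.
have N1 : 0 <= (N%:R : R)^-1 <= 1.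
  by apply/andP; split; [rewrite invr_ge0|rewrite invf_le1 ?ltr0n // ler1n].
apply: le_trans (ler_wpM2l K0 (HC _ N1)) _.
rewrite mulrDr bvE mulrA lerD2l mulrA ler_pdivrMr ?ltr0n // -ler_pdivrMl // mulrC.
apply: ltW; apply: lt_le_trans (archi_boundP KC0) _.
by rewrite ler_nat.
Qed.

Definition volume_scaling (R : realType) d (M : 'M[R]_d) (k : R) :=
  forall x A, vol ((fun u => x + u *m M) @` A) = (k%:E * vol A)%E.


(** The lower bound is the upper bound for the inverse map, again a row operation, whose diagonal
    entry is the inverse of [w 0 k]. *)
Lemma volume_scaling_row_op (R : realType) d (w : 'rV[R]_d) k : 0 < w 0 k ->
  volume_scaling (row_op w k) (w 0 k).
Proof.
move=> wk x A; apply/eqP; rewrite eq_le; apply/andP; split.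
  by apply: vol_image => // a b; apply: vol_row_op_box.
pose w' : 'rV[R]_d := \row_j if j == k then (w 0 k)^-1 else - w 0 j / w 0 k.
have w'k : w' 0 k = (w 0 k)^-1 by rewrite mxE eqxx.
have w'k0 : 0 < w' 0 k by rewrite w'k invr_gt0.
pose B := (fun u => x + u *m row_op w k) @` A.
have AE : A `<=` (fun u => (- (x *m row_op w' k)) + u *m row_op w' k) @` B.
  move=> u Au; exists (x + u *m row_op w k); first by exists u.
  rewrite mulmxDl addrA addNr add0r; apply/rowP => j.
  rewrite mul_row_op mul_row_op eqxx addr0; case: eqP => [->|/eqP/negbTE jk].
    by rewrite w'k addr0 mulfK // gt_eqF.
  by rewrite mul_row_op jk mxE jk; field; rewrite gt_eqF.
have := vol_image w'k0 (fun a b => vol_row_op_box (- (x *m row_op w' k)) a b w'k0) B.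
move=> /(le_trans (le_vol AE)); rewrite w'k -/B => H.
by rewrite -lee_pdivlMl.
Qed.

Definition pos_triangular (R : realType) d (L : 'M[R]_d) :=
  (forall i j : 'I_d, (j < i)%N -> L i j = 0) /\ forall i, 0 < L i i.

Lemma volume_scaling_mul (R : realType) d (M N : 'M[R]_d) k l : 
  volume_scaling M k -> volume_scaling N l -> volume_scaling (M *m N) (k * l).
Proof.
move=> HM HN x A; rewrite mulrC EFinM -muleA -(HM 0) -(HN x); congr vol.
rewrite image_comp; apply: eq_imagel => u _ /=.
by rewrite add0r mulmxA.
Qed.

(** [P k] has the rows of [M] from [k] on and those of the identity above; passing from [P k.+1] to
    [P k] is one row operation. The identity [P d] is itself a row operation. *)
Lemma volume_scaling_triangular (R : realType) d (M : 'M[R]_d) : (0 < d)%N ->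
  pos_triangular M -> volume_scaling M (\prod_i M i i).
Proof.
move=> d0 [M0 M1].
pose P k : 'M[R]_d := \matrix_(i, j) if (k <= i)%N then M i j else (i == j)%:R.
have scalP k : (k <= d)%N -> volume_scaling (P (d - k)%N) (\prod_(i : 'I_d | (d - k <= i)%N) M i i).
  elim: k => [_|k IH kd].
    pose i0 : 'I_d := Ordinal d0; rewrite subn0 big_pred0; last first.
      by move=> i; rewrite leqNgt ltn_ord.
    have -> : P d = row_op (delta_mx 0 i0) i0.
      apply/matrixP => i j; rewrite !mxE leqNgt ltn_ord /=.
      by case: (eqVneq i i0) => [->|//]; rewrite eq_sym.
    have -> : 1 = (delta_mx 0 i0 : 'rV[R]_d) 0 i0 by rewrite mxE !eqxx.
    by apply: volume_scaling_row_op; rewrite mxE !eqxx ltr01.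
  have kd' : (d - k.+1 < d)%N by lia.
  pose k0 := Ordinal kd'; have kE : (d - k = k0.+1)%N by rewrite /=; lia.
  have -> : P (d - k.+1)%N = P (d - k)%N *m row_op (row k0 M) k0.
    apply/row_matrixP => i; apply/rowP => j; rewrite row_mul mul_row_op kE !mxE /=.
    case: (ltngtP (d - k.+1)%N i) => [ki|ik|ik].
    - rewrite (M0 i k0 ki) mul0r add0r; case: eqP => // ->; exact: M0.
    - rewrite (_ : (i == k0) = false); last by apply/eqP => E; rewrite E ltnn in ik.
      rewrite /= mul0r add0r; case: (eqVneq j k0) => // ->.
      by rewrite -val_eqE /= ltn_eqF.
    - have -> : i = k0 by apply: val_inj.
      by rewrite eqxx mul1r eq_sym; case: eqP => _; rewrite addr0.
  rewrite (bigD1 k0) //= mulrC.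
  rewrite [X in X * _](_ : _ = \prod_(i : 'I_d | (d - k <= i)%N) M i i); last first.
    apply: eq_bigl => i; rewrite kE ltn_neqAle -val_eqE /= andbC; congr (_ && _).
    by rewrite eq_sym.
  apply: volume_scaling_mul; first by apply: IH; apply: ltnW.
  rewrite [M k0 k0](_ : _ = row k0 M 0 k0); last by rewrite mxE.
  by apply: volume_scaling_row_op; rewrite mxE.
have := scalP d (leqnn d); rewrite subnn.
by rewrite (_ : P 0%N = M) //; apply/matrixP => i j; rewrite mxE.
Qed.

Definition cube (R : realType) d (C : R) := [set u : 'rV[R]_d | forall i, `|u 0 i| <= C].

Lemma vol_cube_le (R : realType) d (C : R) : (0 < d)%N -> 0 <= C ->
  (vol (@cube R d C) <= ((2 * C) ^+ d)%:E)%E.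
Proof.
move=> d0 C0.
have /= := @vol_finite_cover R d 1 (cube C) (fun=> const_mx (- C)) (fun=> const_mx C) d0.
have -> : \sum_(i < 1) box_vol (const_mx (- C) : 'rV[R]_d) (const_mx C) = (2 * C) ^+ d.
  rewrite big_ord1 /box_vol.
  rewrite (eq_bigr (fun=> 2 * C)) ?prodr_const ?card_ord // => i _; rewrite !mxE.
  by rewrite max_r; lra.
apply=> u uC; exists ord0 => i; rewrite !mxE -ler_norml; exact: uC.
Qed.

Lemma vol_coordinate_hyperplane (R : realType) d (k : 'I_d) :
  vol [set u : 'rV[R]_d | u 0 k = 0] = 0%E.
Proof.
apply/eqP; rewrite eq_le vol_ge0 andbT.
pose b (n : nat) : 'rV[R]_d := \row_i if i == k then 0 else n%:R.
apply: le_trans (vol_cover (a := fun n => - b n) (b := b) _) _.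
  move=> u uk.
  have S0 : 0 <= \sum_i `|u 0 i| by apply: sumr_ge0.
  exists (Num.bound (\sum_i `|u 0 i|)) => // i; rewrite !mxE.
  case: eqP => [->|_]; first by rewrite uk oppr0 lexx.
  rewrite -ler_norml; apply: le_trans (ltW (archi_boundP S0)).
  by rewrite (bigD1 i) //= lerDl sumr_ge0.
rewrite eseries0 // => n _ _.
by rewrite /box_vol (bigD1 k) //= !mxE eqxx !oppr0 addr0 maxxx mul0r.
Qed.

(** With [k] the last index where [f] does not vanish, the hyperplane is the image of a coordinate
    hyperplane under a triangular shear. *)
Lemma vol_hyperplane (R : realType) d (x f : 'rV[R]_d) (A : set 'rV[R]_d) : f != 0 ->
  (forall y, A y -> \sum_i (y - x) 0 i * f 0 i = 0) -> vol A = 0%E.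
Proof.
move=> f0 Af.
have [i0 fi0] : exists i, f 0 i != 0.
  apply: contrapT => /forallNP H; case/eqP: f0; apply/rowP => i; rewrite mxE.
  by apply/eqP/negP => /negP/(H i).
have [k fk kmax] := @arg_maxnP _ i0 (fun i => f 0 i != 0) (fun i : 'I_d => i : nat) fi0.
pose M : 'M[R]_d := \matrix_(i, j)
  if j == k then (if i == k then 1 else - (f 0 i / f 0 k)) else (i == j)%:R.
have triM : pos_triangular M.
  split=> [i j ji|i]; rewrite !mxE; last first.
    by case: eqP => _; rewrite ?eqxx ltr01.
  have [jk|_] := eqVneq j k; last by rewrite -val_eqE /= (gtn_eqF ji).
  have ki : (k < i)%N by rewrite -jk.
  have -> : (i == k) = false by apply/eqP => E; rewrite E ltnn in ki.
  suff -> : f 0 i = 0 by rewrite mul0r oppr0.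
  by apply/eqP; apply: contraTT ki => /kmax; rewrite -leqNgt.
have d0 : (0 < d)%N by apply: leq_ltn_trans (ltn_ord k).
apply/eqP; rewrite eq_le vol_ge0 andbT.
have := volume_scaling_triangular d0 triM x [set u | u 0 k = 0].
rewrite vol_coordinate_hyperplane mule0 => <-; apply: le_vol => y /Af Ay.
pose u : 'rV[R]_d := \row_i if i == k then 0 else (y - x) 0 i.
exists u; first by rewrite /= mxE eqxx.
suff /= -> : u *m M = y - x by rewrite addrC subrK.
apply/rowP => j.
rewrite mxE; have [->|jk] := eqVneq j k.
  rewrite (bigD1 k) //= !mxE eqxx mul0r add0r.
  move: Ay; rewrite (bigD1 k) //= => /eqP; rewrite addr_eq0 => /eqP Ay.
  apply: (mulIf fk); rewrite mulr_suml [RHS](_ : _ = (y - x) 0 k * f 0 k); last by rewrite !mxE.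
  rewrite Ay -sumrN; apply: eq_bigr => i /negbTE ik; rewrite !mxE ik eqxx.
  by field.
rewrite (bigD1 j) //= !mxE (negbTE jk) eqxx mulr1 big1 ?addr0 // => i /negbTE ij.
by rewrite !mxE (negbTE jk) ij mulr0.
Qed.

(** * Parallelepipeds inside convex sets *)

Definition parall (R : realType) d (x : 'rV[R]_d) (L : 'M[R]_d) :=
  (fun u => x + u *m L) @` cube 1.

Lemma independent_differences (R : realType) d (F : set 'rV[R]_d) x :
  (forall f : 'rV[R]_d, f != 0 -> exists2 y, F y & \sum_i (y - x) 0 i * f 0 i <> 0) ->
  exists2 Y : 'M[R]_d, Y \in unitmx & forall i, F (x + row i Y).
Proof.
move=> nflat.
have H k : (k <= d)%N -> exists2 Y : 'M[R]_(k, d), row_free Y & forall i, F (x + row i Y).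
  elim: k => [_|k IH kd].
    exists 0; last by case.
    by rewrite /row_free -leqn0 rank_leq_row.
  have [Y Yfree FY] := IH (ltnW kd).
  have rY : \rank Y = k by apply/eqP.
  have [j cj] : exists j, col j (cokermx Y) != 0.
    apply: contrapT => /forallNP H; have : cokermx Y = 0.
      apply/matrixP => i j; have /negP := H j; rewrite negbK => /eqP/matrixP/(_ i 0).
      by rewrite !mxE.
    move=> /(congr1 mxrank); rewrite mxrank_coker rY mxrank0 => /eqP.
    by rewrite subn_eq0 leqNgt kd.
  have [|y Fy yj] := nflat (col j (cokermx Y))^T.
    by rewrite -(inj_eq (@trmx_inj _ _ _)) trmxK trmx0.
  have nsub : ~~ (y - x <= Y)%MS.
    apply/negP; rewrite submxE => /eqP/rowP/(_ j); rewrite [in RHS]mxE => E; apply: yj.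
    by rewrite -[RHS]E mxE; apply: eq_bigr => i _; rewrite !mxE.
  exists (col_mx (y - x) Y : 'M[R]_(1 + k, d)).
    rewrite /row_free eqn_leq rank_leq_row /=.
    suff : (\rank Y < \rank (col_mx (y - x) Y))%N by rewrite rY.
    rewrite -addsmxE; apply: rank_ltmx.
    by rewrite ltmxE addsmxSr addsmx_sub (negbTE nsub).
  move=> i; have [i' ->|i' ->] := split_ordP (i : 'I_(1 + k)).
    have -> : row (lshift k i') (col_mx (y - x) Y) = y - x by rewrite rowKu ord1 row_id.
    by rewrite addrC subrK.
  by have -> : row (rshift 1 i') (col_mx (y - x) Y) = row i' Y by rewrite rowKd.
have [Y Yfree FY] := H d (leqnn d).
by exists Y => //; rewrite -row_free_unit.
Qed.

Lemma convex_simplex (R : realType) d (F : set 'rV[R]_d) x (Y : 'M[R]_d) (l : 'rV[R]_d) :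
  convex F -> F x -> (forall i, F (x + row i Y)) ->
  (forall i, 0 <= l 0 i) -> \sum_i l 0 i <= 1 -> F (x + l *m Y).
Proof.
move=> cF Fx FY l0 l1.
pose w (i : 'I_d.+1) := if unlift ord0 i is Some j then l 0 j else 1 - \sum_j l 0 j.
pose y (i : 'I_d.+1) := if unlift ord0 i is Some j then x + row j Y else x.
rewrite [x + _](_ : _ = \sum_i w i *: y i).
  apply: convex_sum => //.
  - by move=> i; rewrite /w; case: unlift => [j //|]; rewrite subr_ge0.
  - by move=> i _; rewrite /y; case: unlift.
  - by rewrite big_ord_recl /w unlift_none; under [X in _ + X]eq_bigr do rewrite liftK; rewrite subrK.
rewrite big_ord_recl /w /y unlift_none; under [X in _ = _ + X]eq_bigr do rewrite liftK scalerDr.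
by rewrite big_split /= -scaler_suml addrA -scalerDl subrK scale1r mulmx_sum_row.
Qed.

Definition entry_sum (R : realType) d (M : 'M[R]_d) := \sum_i \sum_j `|M i j|.

Lemma entry_sum_ge0 (R : realType) d (M : 'M[R]_d) : 0 <= entry_sum M.
Proof. by apply: sumr_ge0 => i _; apply: sumr_ge0. Qed.

Lemma cube_mul (R : realType) d (C : R) (M : 'M[R]_d) u :
  cube C u -> cube (C * entry_sum M) (u *m M).
Proof.
move=> uC j; rewrite mxE; apply: le_trans (ler_norm_sum _ _ _) _.
rewrite mulr_sumr; apply: ler_sum => i _; rewrite normrM.
apply: ler_pM => //; by rewrite (bigD1 j) //= lerDl sumr_ge0.
Qed.

Lemma parall_of_simplex (R : realType) d (F : set 'rV[R]_d) x (Y : 'M[R]_d) : (0 < d)%N ->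
  convex F -> F x -> Y \in unitmx -> (forall i, F (x + row i Y)) ->
  exists x' L, pos_triangular L /\ parall x' L `<=` F.
Proof.
move=> d0 cF Fx uY FY.
(* Around the point whose coordinates in [Y] all equal [c], perturbations by at most [c] stay in
   [0, 2c], and 2cd = 1. *)
pose c : R := (2 * d%:R)^-1.
have c0 : 0 < c by rewrite invr_gt0 mulr_gt0 // ltr0n.
have S1 : 0 < 1 + entry_sum (invmx Y) by rewrite ltr_wpDr // entry_sum_ge0.
pose eta := c / (1 + entry_sum (invmx Y)).
have e0 : 0 < eta by rewrite divr_gt0.
exists (x + const_mx c *m Y), (eta%:M); split.
  split=> [i j ji|i]; rewrite mxE ?eqxx //.
  by rewrite -val_eqE /= (gtn_eqF ji).
move=> _ [u u1 <-].
rewrite -addrA mul_mx_scalar -[eta *: u](mulmxKV uY) -mulmxDl.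
have bnd j : `|(eta *: u *m invmx Y) 0 j| <= c.
  apply: le_trans (_ : eta * entry_sum (invmx Y) <= c).
    apply: cube_mul => i; rewrite mxE normrM gtr0_norm //.
    by apply: ler_piMr; [apply: ltW|apply: u1].
  by rewrite /eta mulrAC ler_pdivrMr // mulrDr lerDr mulr1 ltW.
apply: convex_simplex => //.
  move=> j; rewrite mxE [const_mx c 0 j]mxE; have := bnd j; rewrite ler_norml => /andP[+ _]; lra.
apply: le_trans (_ : \sum_(j < d) (2 * c) <= 1).
  apply: ler_sum => j _; rewrite mxE [const_mx c 0 j]mxE.
  have := bnd j; rewrite ler_norml => /andP[_ +]; lra.
rewrite sumr_const card_ord -[_ *+ _]mulr_natl /c.
rewrite (_ : d%:R * (2 * (2 * d%:R)^-1) = 1) //; field.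
by rewrite pnatr_eq0 -lt0n.
Qed.

Lemma volume_contains_parall (R : realType) d (F : set 'rV[R]_d) : (0 < d)%N ->
  convex F -> (0 < vol F)%E -> exists x L, pos_triangular L /\ parall x L `<=` F.
Proof.
move=> d0 cF vF.
have [x Fx] : exists x, F x.
  apply: contrapT => /forallNP F0; move: vF; rewrite ltNge.
  suff -> : (vol F <= 0)%E by [].
  apply: le_trans (vol_finite_cover (n := 0) (a := fun=> 0) (b := fun=> 0) d0 _) _.
    by move=> y /F0.
  by rewrite big_ord0.
have [|Y uY FY] := @independent_differences R d F x.
  move=> f f0; apply: contrapT => H; move: vF.
  rewrite (vol_hyperplane f0 (x := x)) ?ltxx // => y Fy.
  by apply: contrapT => E; apply: H; exists y.
exact: parall_of_simplex FY.
Qed.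

Lemma pos_triangular_mul (R : realType) d (L M : 'M[R]_d) :
  pos_triangular L -> pos_triangular M ->
  pos_triangular (L *m M) /\ \prod_i (L *m M) i i = (\prod_i L i i) * \prod_i M i i.
Proof.
move=> [L0 L1] [M0 M1].
have diag i : (L *m M) i i = L i i * M i i.
  rewrite mxE (bigD1 i) //= big1 ?addr0 // => j ji.
  have [lt|gt|/val_inj E] := ltngtP j i; first by rewrite L0 // mul0r.
    by rewrite M0 // mulr0.
  by rewrite E eqxx in ji.
split; last by rewrite -big_split; apply: eq_bigr => i _; apply: diag.
split=> [i j ji|i]; last by rewrite diag mulr_gt0.
rewrite mxE big1 // => k _; have [ki|ik] := ltnP k i; first by rewrite L0 // mul0r.
by rewrite M0 ?mulr0 // (leq_trans ji).
Qed.

Lemma pos_triangular_unit (R : realType) d (L : 'M[R]_d) : pos_triangular L -> L \in unitmx.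
Proof.
move=> [L0 L1]; rewrite unitmxE -det_tr det_trig.
  by rewrite unitfE gt_eqF // prodr_gt0 // => i _; rewrite mxE.
by apply/is_trig_mxP => i j ij; rewrite mxE L0.
Qed.

(** If earlier coordinates are at most [C], the parallelepiped of [extremal_cube_bound] has
    determinant 2^-d |y_k| / (2(C + 1)). It is at most 2, which bounds |y_k| by 2^(d + 2) (C +
    1). *)
Fixpoint coord_bound (R : realType) d (k : nat) : R :=
  if k is k'.+1 then 2 ^+ d.+2 * (coord_bound R d k' + 1) else 1.

Lemma coord_bound_mono (R : realType) d k :
  1 <= coord_bound R d k <= coord_bound R d k.+1.
Proof.
have step (C : R) : 1 <= C -> C <= 2 ^+ d.+2 * (C + 1).
  move=> C1; rewrite -[leLHS]mul1r; apply: ler_pM => //; try lra.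
  by rewrite exprn_ege1 // ler1n.
elim: k => [|k /andP[H1 H2]]; first by rewrite lexx step.
have H3 : 1 <= coord_bound R d k.+1 by apply: le_trans H2.
by rewrite H3 step.
Qed.

(* If [y] has a large [k]-th coordinate, cancelling its earlier coordinates
   against the cube gives [y'], and the convex hull of [y'] and the cube
   contains a parallelepiped with [k]-th edge [y' / 4]. *)
Lemma extremal_cube_bound (R : realType) d (F : set 'rV[R]_d) :
  convex F -> cube 1 `<=` F ->
  (forall x L, pos_triangular L -> parall x L `<=` F -> \prod_i L i i <= 2) ->
  F `<=` cube (coord_bound R d d).
Proof.
move=> cF F1 Fmax y Fy.
suff H k : (k <= d)%N -> forall i : 'I_d, (i < k)%N -> `|y 0 i| <= coord_bound R d k.
  by move=> i; apply: H (ltn_ord i).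
elim: k => // k IH kd i; rewrite ltnS leq_eqVlt => /predU1P[ik|ik]; last first.
  by apply: le_trans (IH (ltnW kd) _ ik) _; have /andP[] := coord_bound_mono R d k.
have {}IH := IH (ltnW kd).
have /andP[C1 _] := coord_bound_mono R d k.
rewrite /=; set C := coord_bound R d k in IH C1 *.
have C0 : 0 < C by lra.
have [yi0|yi0] := eqVneq (y 0 i) 0.
  by rewrite yi0 normr0 mulr_ge0 ?exprn_ge0 //; lra.
(* Then [1 - e = e * C], so the coordinates [- y 0 j / C] of [u] cancel exactly and still lie in the
   cube. *)
pose e := (C + 1)^-1.
have e0 : 0 < e by rewrite invr_gt0; lra.
have e1 : e <= 1 by rewrite invf_le1; lra.
have eC : e * (C + 1) = 1 by rewrite mulVf // gt_eqF //; lra.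
pose u : 'rV[R]_d := \row_j if (j < k)%N then - y 0 j / C else 0.
have uF : F u.
  apply: F1 => j; rewrite mxE; case: ifP => jk; last by rewrite normr0.
  by rewrite mulNr normrN normf_div [`|C|]gtr0_norm // ler_pdivrMr // mul1r IH.
pose y' := e *: y + (1 - e) *: u.
have Fy' : F y' by apply: cF => //; rewrite ltW.
have y'0 (j : 'I_d) : (j < k)%N -> y' 0 j = 0.
  move=> jk; rewrite !mxE jk; have -> : 1 - e = e * C by rewrite -eC; ring.
  by field; rewrite gt_eqF.
have y'i : y' 0 i = e * y 0 i by rewrite !mxE ik ltnn mulr0 addr0.
clearbody y' => {u uF}.
pose s := Num.sg (y 0 i).
have s1 : `|s| = 1 by rewrite normr_sg yi0.
pose L := 2^-1 *: row_op ((s / 2) *: y') i.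
have Lii : L i i = 2^-1 * (e * `|y 0 i| / 2).
  by rewrite !mxE eqxx y'i [`|_|]normrEsg -/s; ring.
have Lij a b : a != i -> L a b = 2^-1 * (a == b)%:R by move=> /negbTE ai; rewrite !mxE ai.
have triL : pos_triangular L.
  split=> [a b ba|a]; have [ai|ai] := eqVneq a i.
  - rewrite !mxE ai eqxx y'0 ?mulr0 //.
    by rewrite -ik -ai.
  - by rewrite Lij // -val_eqE /= (gtn_eqF ba) mulr0.
  - by rewrite ai Lii !mulr_gt0 // ?invr_gt0 // normr_gt0.
  - by rewrite Lij // eqxx mulr1 invr_gt0.
have detL : \prod_a L a a = 2^-1 ^+ d * (e * `|y 0 i| / 2).
  rewrite (bigD1 i) //= Lii mulrAC; congr (_ * _).
  rewrite -[X in _ ^+ X]card_ord -prodr_const [RHS](bigD1 i) //=.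
  by congr (_ * _); apply: eq_bigr => a ai; rewrite Lij // eqxx mulr1.
have : \prod_a L a a <= 2.
  apply: (Fmax (4^-1 *: y')) => //.
  move=> _ [t t1 <-].
  (* The weight of [y']: it varies with the [i]-th parameter but never exceeds 1/2, which leaves the
     cube enough weight for edges of half size. *)
  pose l := (1 + s * t 0 i) / 4.
  have st : `|s * t 0 i| <= 1 by rewrite normrM s1 mul1r; exact: t1.
  have l01 : 0 <= l <= 2^-1.
    by move: st; rewrite ler_norml /l => /andP[? ?]; apply/andP; split; lra.
  have l1 : 0 < 1 - l by move: l01 => /andP[]; lra.
  pose t' : 'rV[R]_d := \row_j if j == i then 0 else t 0 j / (2 * (1 - l)).
  have -> : 4^-1 *: y' + t *m L = l *: y' + (1 - l) *: t'.
    apply/rowP => j.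
    have E : (t *m L) 0 j = 2^-1 * (t 0 i * (s / 2 * y' 0 j) + (if j == i then 0 else t 0 j)).
      by rewrite -scalemxAr mxE mul_row_op [(_ *: y') 0 j]mxE.
    rewrite mxE E [RHS]mxE ![(_ *: y') 0 j]mxE [(_ *: t') 0 j]mxE [t' 0 j]mxE.
    case: eqP => _; first by rewrite /l; field.
    have -> : (1 - l) * (t 0 j / (2 * (1 - l))) = t 0 j / 2 by field; rewrite gt_eqF.
    by rewrite /l; field.
  apply: cF => //; last by move: l01 => /andP[]; lra.
  apply: F1 => j; rewrite mxE; case: eqP => _; first by rewrite normr0.
  rewrite normf_div [`|_ * _|]gtr0_norm; last by lra.
  rewrite ler_pdivrMr; last by lra.
  have := t1 j; move: l01 => /andP[]; lra.
rewrite detL => H.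
have Z : (2 : R) ^+ d * 2^-1 ^+ d = 1 by rewrite -exprMn divff ?expr1n // pnatr_eq0.
have P0 : 0 < (C + 1) * 2 * 2 ^+ d by rewrite !mulr_gt0 ?exprn_gt0 //; lra.
have := ler_wpM2l (ltW P0) H.
have -> : (C + 1) * 2 * 2 ^+ d * (2^-1 ^+ d * (e * `|y 0 i| / 2)) =
    (2 ^+ d * 2^-1 ^+ d) * (e * (C + 1)) * `|y 0 i| by field.
rewrite Z eC !mul1r => /le_trans; apply.
by rewrite !exprS; lra.
Qed.

(** * Fat convex sets *)

Definition fat (R : realType) d (K : set 'rV[R]_d) (c : R) :=
  exists x L, [/\ pos_triangular L, c <= \prod_i L i i & parall x L `<=` K].

(** A John-type argument with cubes. If no determinant reaches 1, the supremum is finite; it need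
    not be attained, so a parallelepiped within a factor 2 of it is moved to the unit cube, whence
    the 2 in [extremal_cube_bound]. Then [F] lies in a dilate of that parallelepiped, and its volume
    bounds the determinant from below. *)
Lemma fat_of_volume (R : realType) d : (0 < d)%N -> exists2 c : R, 0 < c &
  forall F : set 'rV[R]_d, convex F -> (1%:E <= vol F)%E -> fat F c.
Proof.
move=> d0; pose C := coord_bound R d d.
have C1 : 1 <= C by have /andP[] := coord_bound_mono R d d.
have C0 : 0 < (2 * C) ^+ d by rewrite exprn_gt0 //; lra.
exists ((2 * C) ^+ d)^-1; first by rewrite invr_gt0.
move=> F cF vF.
have [|x1 [L1 [tri1 sub1]]] := volume_contains_parall d0 cF.
  by apply: lt_le_trans vF; rewrite lte_fin.
have [[x [L [triL detL subL]]]|nbig] :=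
  pselect (exists x L, [/\ pos_triangular L, 1 <= \prod_i L i i & parall x L `<=` F]).
  exists x, L; split=> //; apply: le_trans detL.
  by rewrite invf_le1 // exprn_ege1 //; lra.
pose S := [set s : R | exists x L, [/\ pos_triangular L, parall x L `<=` F & s = \prod_i L i i]].
have Sub : has_ubound S.
  exists 1 => _ [x [L [triL subL ->]]]; rewrite leNgt; apply/negP => /ltW big.
  by apply: nbig; exists x, L.
have S1 : S (\prod_i L1 i i) by exists x1, L1.
have sup0 : 0 < sup S.
  apply: lt_le_trans (ub_le_sup Sub S1).
  by apply: prodr_gt0 => i _; apply: tri1.2.
have sup2 : 0 < sup S / 2 by rewrite divr_gt0.
have [_ [x [L [triL subL ->]]] detL] := sup_adherent sup2 (conj (ex_intro _ _ S1) Sub).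
exists x, L; split=> //.
have L0 : 0 < \prod_i L i i by apply: prodr_gt0 => i _; apply: triL.2.
pose F' := [set u | F (x + u *m L)].
have F'C : F' `<=` cube C.
  apply: extremal_cube_bound.
  - move=> u v t Fu Fv t01; rewrite /F' /=.
    have -> : x + (t *: u + (1 - t) *: v) *m L = t *: (x + u *m L) + (1 - t) *: (x + v *m L).
      rewrite mulmxDl -!scalemxAl !scalerDr addrACA -scalerDl.
      by rewrite [t + _]addrC subrK scale1r.
    exact: cF.
  - by move=> u u1; apply: subL; exists u.
  - move=> x' L' tri' sub'.
    have [triLL detLL] := pos_triangular_mul tri' triL.
    have : S (\prod_i (L' *m L) i i).
      exists (x + x' *m L), (L' *m L); split=> // _ [u u1 <-].
      rewrite mulmxA -addrA -mulmxDl; apply: sub'.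
      by exists u.
    move=> /(ub_le_sup Sub); rewrite detLL => H.
    rewrite -(ler_pM2r L0); lra.
have FE : F `<=` (fun u => x + u *m L) @` cube C.
  move=> y Fy; have uL := pos_triangular_unit triL.
  have yE : x + (y - x) *m invmx L *m L = y by rewrite mulmxKV // addrC subrK.
  by exists ((y - x) *m invmx L) => //; apply: F'C; rewrite /F' /= yE.
have := le_trans vF (le_vol FE).
rewrite volume_scaling_triangular // => /le_trans H.
have : (1%:E <= (\prod_i L i i)%:E * ((2 * C) ^+ d)%:E)%E.
  apply: H; apply: lee_wpmul2l; first by rewrite lee_fin ltW.
  by apply: vol_cube_le => //; lra.
by rewrite -EFinM lee_fin -ler_pdivrMr // div1r.
Qed.

Lemma pos_triangular_block (R : realType) d (e : R) (w : 'rV[R]_d) (L : 'M[R]_d) :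
  0 < e -> pos_triangular L ->
  let M := block_mx e%:M w 0 L : 'M[R]_(1 + d) in
  pos_triangular M /\ \prod_i M i i = e * \prod_i L i i.
Proof.
move=> e0 [L0 L1] M; split; last first.
  rewrite big_split_ord /= big_ord1 block_mxEul mxE eqxx; congr (_ * _).
  by apply: eq_bigr => i _; rewrite block_mxEdr.
split=> i.
  move=> j; have [i' ->|i' ->] := split_ordP i; have [j' ->|j' ->] := split_ordP j.
  - by rewrite !ord1.
  - by rewrite ord1.
  - by rewrite block_mxEdl mxE.
  - by rewrite block_mxEdr /= ltn_add2l; apply: L0.
have [i' ->|i' ->] := split_ordP i; last by rewrite block_mxEdr.
by rewrite block_mxEul mxE ord1 eqxx.
Qed.

Lemma pos_triangular_split (R : realType) d (L : 'M[R]_(1 + d)) : pos_triangular L ->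
  exists e (w : 'rV[R]_d) (L' : 'M[R]_d),
    [/\ 0 < e, pos_triangular L' & L = block_mx e%:M w 0 L'].
Proof.
move=> [L0 L1]; exists (ulsubmx L 0 0), (ursubmx L), (drsubmx L); split.
- by rewrite !mxE.
- split=> [i j ji|i]; rewrite !mxE //.
  by apply: L0; rewrite /= ltn_add2l.
rewrite -mx11_scalar -[in LHS](submxK L); congr block_mx.
by apply/matrixP => i j; rewrite !mxE; apply: L0; rewrite /= ord1.
Qed.

Lemma mul_row_triangular (R : realType) d (s t e : R) (x w u : 'rV[R]_d) (L : 'M[R]_d) :
  row_mx s%:M x + row_mx t%:M u *m block_mx e%:M w 0 L
  = row_mx (s + t * e)%:M (x + t *: w + u *m L) :> 'rV[R]_(1 + d).
Proof.
rewrite mul_row_block mulmx0 addr0 -scalar_mxM mul_scalar_mx add_row_mx.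
by rewrite -raddfD addrA.
Qed.

Lemma cube_row_mx (R : realType) d (C t : R) (u : 'rV[R]_d) :
  cube C (row_mx t%:M u : 'rV[R]_(1 + d)) <-> `|t| <= C /\ cube C u.
Proof.
split=> [H|[t1 u1] i].
  split=> [|i]; first by have := H (lshift d 0); rewrite row_mxEl mxE eqxx.
  by have := H (rshift 1 i); rewrite row_mxEr.
have [i' ->|i' ->] := split_ordP i; last by rewrite row_mxEr.
by rewrite row_mxEl mxE ord1 eqxx.
Qed.

Lemma fat_rfat (R : realType) d (K : set 'rV[R]_d) v : fat K v -> rfat K v.
Proof.
elim: d K v => [|d IH] K v [x [L [triL detL subL]]] /=.
  split; first by move: detL; rewrite big_ord0.
  have E : x + 0 *m L = 0 by rewrite [LHS]thinmx0.
  by rewrite -E; apply: subL; exists 0 => // -[].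
have [e [w [L' [e0 triL' LE]]]] := pos_triangular_split triL.
move: detL subL; rewrite LE (pos_triangular_block w e0 triL').2 => detL subL.
pose s := lsubmx (x : 'rV_(1 + d)) 0 0.
exists s, e; split=> // tau tauI; apply: IH.
pose t := (tau - s) / e.
have t1 : `|t| <= 1.
  move: tauI => /andP[? ?]; rewrite ger0_norm ?ler_pdivrMr // /t; first by lra.
  by rewrite divr_ge0 ?(ltW e0) // subr_ge0.
exists (rsubmx (x : 'rV_(1 + d)) + t *: w), L'; split=> //.
  by rewrite ler_pdivrMr // mulrC.
move=> _ [u u1 <-]; apply: subL; exists (row_mx t%:M u); first exact/cube_row_mx.
rewrite [x]row_mx_scalar mul_row_triangular -/s row_mxKr.
by have -> : s + t * e = tau by rewrite /t divfK ?gt_eqF // addrC subrK.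
Qed.

(** Only the two end slices matter: a parallelepiped at height [s] and a point [q] at height
    [s + e]. Their hull contains one with first edge a quarter of the way from [x] to [q] and the
    other edges halved. *)
Lemma rfat_fat (R : realType) d : exists2 c : R, 0 < c &
  forall (K : set 'rV[R]_d) v, convex K -> rfat K v -> fat K (c * v).
Proof.
elim: d => [|d [c c0 IH]].
  exists 1 => // K v cK /= [v1 K0]; exists 0, 0; split; first by split=> -[].
    by rewrite big_ord0 mul1r.
  by move=> _ [u _ <-]; rewrite [_ + _]thinmx0.
exists (c * (4^-1 * 2^-1 ^+ d)); first by rewrite !mulr_gt0 // exprn_gt0.
move=> K v cK /= [s [e [e0 H]]].
have se : s <= s <= s + e by rewrite lexx lerDl ltW.
have se' : s <= s + e <= s + e by rewrite lexx lerDl ltW.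
have [x [L [triL detL subL]]] := IH _ _ (convex_slice cK) (H _ se).
have [q Kq] := rfat_nonempty (H _ se').
have e4 : 0 < e / 4 by rewrite divr_gt0.
have triL2 : pos_triangular (2^-1 *: L).
  split=> [i j ji|i]; rewrite mxE; first by rewrite triL.1 // mulr0.
  by rewrite mulr_gt0 ?invr_gt0 //; apply: triL.2.
have [triM detM] := pos_triangular_block (4^-1 *: (q - x)) e4 triL2.
exists (row_mx (s + e / 4)%:M (x + 4^-1 *: (q - x))).
exists (block_mx (e / 4)%:M (4^-1 *: (q - x)) 0 (2^-1 *: L)); split; first exact: triM.
  rewrite detM (eq_bigr (fun i => 2^-1 * L i i)); last by move=> i _; rewrite mxE.
  rewrite big_split prodr_const card_ord /=.
  have -> : c * (4^-1 * 2^-1 ^+ d) * v = c * (v / e) * (e / 4 * 2^-1 ^+ d).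
    by field; rewrite gt_eqF.
  rewrite [leRHS](_ : _ = \prod_i L i i * (e / 4 * 2^-1 ^+ d)); last by ring.
  by rewrite ler_pM2r // mulr_gt0 // exprn_gt0.
move=> _ [u u1 <-]; rewrite [u]row_mx_scalar mul_row_triangular.
have /cube_row_mx[] :
    cube 1 (row_mx (lsubmx (u : 'rV_(1 + d)) 0 0)%:M (rsubmx (u : 'rV_(1 + d)))).
  by rewrite -row_mx_scalar.
set t := lsubmx _ 0 0; set w := rsubmx _ => t1 w1.
pose l := (1 + t) / 4.
have l01 : 0 <= l <= 2^-1 by move: t1; rewrite ler_norml /l; lra.
have l1 : 0 < 1 - l by lra.
pose w' := (2 * (1 - l))^-1 *: w.
rewrite [row_mx _ _](_ : _ =
    l *: row_mx (s + e)%:M q + (1 - l) *: row_mx s%:M (x + w' *m L)); last first.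
  rewrite row_mx_combination; congr row_mx.
    by congr (_%:M); rewrite /l; field.
  apply/rowP => j; rewrite -scalemxAr /w' -scalemxAl !mxE.
  set a := \sum_k _; clearbody a.
  have -> : (1 - l) * (x 0 j + (2 * (1 - l))^-1 * a) = (1 - l) * x 0 j + 2^-1 * a.
    by field; rewrite gt_eqF.
  by rewrite /l; field.
apply: cK; [exact: Kq| |by lra].
apply: subL; exists w' => // j; rewrite mxE normrM gtr0_norm ?invr_gt0; last by lra.
by rewrite ler_pdivrMl; [have := w1 j; lra|lra].
Qed.

(** * Lifting parallelepipeds to points, and back to bodies of equal volume *)

Lemma log_concave_prod (R : realType) (I : finType) (a b : I -> R) (c t : R) : 0 < c ->
  (forall i, 0 < a i) -> (forall i, 0 < b i) -> 0 <= t <= 1 ->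
  c <= \prod_i a i -> c <= \prod_i b i -> c <= \prod_i (t * a i + (1 - t) * b i).
Proof.
move=> c0 a0 b0 /andP[t0 t1] ca cb.
have [->|tN0] := eqVneq t 0.
  by rewrite (eq_bigr b) // => i _; rewrite mul0r add0r subr0 mul1r.
have [->|tN1] := eqVneq t 1.
  by rewrite (eq_bigr a) // => i _; rewrite subrr mul0r addr0 mul1r.
have t0' : 0 < t by rewrite lt_neqAle eq_sym tN0.
have t1' : 0 < 1 - t by rewrite subr_gt0 lt_neqAle tN1.
have m0 i : 0 < t * a i + (1 - t) * b i by rewrite addr_gt0 // mulr_gt0.
have lnprod (f : I -> R) : (forall i, 0 < f i) -> ln (\prod_i f i) = \sum_i ln (f i).
  move=> f0; suff [_ //] : 0 < \prod_i f i /\ ln (\prod_i f i) = \sum_i ln (f i).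
  apply: (big_rec2 (fun p s => 0 < p /\ ln p = s)); first by rewrite ln1.
  by move=> i s p _ [p0 <-]; rewrite mulr_gt0 // lnM ?posrE.
have pos f : (forall i, 0 < f i) -> \prod_i f i \is @Num.pos R.
  by move=> f0; rewrite posrE prodr_gt0.
rewrite -ler_ln ?pos ?posrE // lnprod //.
apply: le_trans (_ : \sum_i (t * ln (a i) + (1 - t) * ln (b i)) <= _); last first.
  apply: ler_sum => i _.
  have t01 : 0 <= t <= 1 by rewrite t0.
  have := concave_ln (Itv01 t0 t1) (a0 i) (b0 i).
  by rewrite !convRE.
rewrite big_split -!mulr_sumr -!lnprod //=.
have -> : ln c = t * ln c + (1 - t) * ln c by ring.
by apply: lerD; rewrite ler_pM2l // ler_ln ?pos ?posrE.
Qed.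

(* A point of R^(d + d^2) encodes a parallelepiped [parall x L]. *)
Definition lifted (R : realType) d (c : R) (F : set 'rV[R]_d) : set 'rV[R]_(d + d * d) :=
  [set z | let L := vec_mx (rsubmx z) in
    [/\ pos_triangular L, c <= \prod_i L i i & parall (lsubmx z) L `<=` F]].

Lemma lifted_fat (R : realType) d (c : R) (F : set 'rV[R]_d) x L :
  pos_triangular L -> c <= \prod_i L i i -> parall x L `<=` F ->
  lifted c F (row_mx x (mxvec L)).
Proof. by move=> triL cL subL; rewrite /lifted /= row_mxKl row_mxKr mxvecK; split. Qed.

Lemma convex_lifted (R : realType) d (c : R) (F : set 'rV[R]_d) : 0 < c ->
  convex F -> convex (lifted c F).
Proof.
move=> c0 cF z z' t [tri1 det1 sub1] [tri2 det2 sub2] t01.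
have /andP[t0 t1] := t01.
rewrite /lifted /= !linearP /= !linearZ /=.
set L := vec_mx (rsubmx z) in tri1 det1 sub1 *.
set L' := vec_mx (rsubmx z') in tri2 det2 sub2 *.
have LE i j : (t *: L + (1 - t) *: L') i j = t * L i j + (1 - t) * L' i j.
  by rewrite !mxE.
split.
- split=> [i j ji|i]; rewrite LE.
    by rewrite tri1.1 // tri2.1 // !mulr0 addr0.
  have := tri1.2 i; have := tri2.2 i; have [->|tN0] := eqVneq t 0 => ? ?.
    by rewrite mul0r add0r subr0 mul1r.
  rewrite ltr_pwDl ?mulr_gt0 ?mulr_ge0 ?subr_ge0 // ?(ltW) //.
  by rewrite lt_neqAle eq_sym tN0.
- rewrite (eq_bigr _ (fun i _ => LE i i)); apply: log_concave_prod => //.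
    by move=> i; apply: tri1.2.
  by move=> i; apply: tri2.2.
- move=> _ [u u1 <-]; rewrite mulmxDr -!scalemxAr addrACA -!scalerDr.
  by apply: cF => //; [apply: sub1|apply: sub2]; exists u.
Qed.

Lemma convex_parall (R : realType) d (x : 'rV[R]_d) L : convex (parall x L).
Proof.
move=> _ _ t [u u1 <-] [w w1 <-] /andP[t0 t1].
exists (t *: u + (1 - t) *: w).
  move=> i; rewrite !mxE; apply: le_trans (ler_normD _ _) _; rewrite !normrM.
  have t1' : 0 <= 1 - t by rewrite subr_ge0.
  rewrite (ger0_norm t0) (ger0_norm t1').
  rewrite [leRHS](_ : 1 = t * 1 + (1 - t) * 1); last by ring.
  by apply: lerD; apply: ler_wpM2l.
rewrite mulmxDl -!scalemxAl !scalerDr addrACA -scalerDl.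
by rewrite [t + _]addrC subrK scale1r.
Qed.

Lemma compact_parall (R : realType) d (x : 'rV[R]_d) L : compact (parall x L).
Proof.
pose f (w : 'rV[R]_d) := x - const_mx 1 *m L + \sum_i w 0 i *: row i (2 *: L).
have -> : parall x L = f @` [set u : 'rV[R]_d | forall i, 0 <= u 0 i <= 1].
  have fE w : f w = x + (2 *: w - const_mx 1) *m L.
    rewrite /f -(mulmx_sum_row w (2 *: L)) mulmxBl -scalemxAl -scalemxAr addrAC.
    by rewrite -addrA.
  apply/seteqP; split=> _ [u u1 <-].
    exists (2^-1 *: (u + const_mx 1)).
      by move=> i; rewrite !mxE; have := u1 i; rewrite ler_norml; lra.
    by rewrite fE scalerA divff ?pnatr_eq0 // scale1r addrK.
  exists (2 *: u - const_mx 1); last by rewrite fE.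
  by move=> i; rewrite !mxE ler_norml; have := u1 i; lra.
apply: continuous_compact; last exact: compact_unit_cube.
apply: continuous_subspaceT => w.
apply: (@continuousD R _ _ (fun=> x - const_mx 1 *m L)); first exact: cst_continuous.
exact: continuous_lincomb.
Qed.

Lemma interior_parall (R : realType) d (x : 'rV[R]_d) L : L \in unitmx ->
  (parall x L)° x.
Proof.
move=> uL; have S1 : 0 < 1 + entry_sum (invmx L) by rewrite ltr_wpDr // entry_sum_ge0.
apply/nbhs_ballP; exists (1 + entry_sum (invmx L))^-1 => /=; first by rewrite invr_gt0.
move=> y xy; exists ((y - x) *m invmx L); last by rewrite mulmxKV // addrC subrK.
move=> j; apply: le_trans (_ : (1 + entry_sum (invmx L))^-1 * entry_sum (invmx L) <= 1).
  apply: cube_mul => i; rewrite !mxE distrC.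
  by have := xy.2 0 i; rewrite -ball_normE /= => /ltW.
by rewrite mulrC ler_pdivrMr // mul1r lerDr.
Qed.

Lemma vol_cube_eq0 (R : realType) d (A : set 'rV[R]_d) : (0 < d)%N ->
  vol (@cube R d 1) = 0%E -> vol A = 0%E.
Proof.
move=> d0 v0; apply/eqP; rewrite eq_le vol_ge0 andbT.
apply: le_trans (_ : vol (\bigcup_n cube n.+1%:R) <= _)%E.
  apply: le_vol => u _.
  have S0 : 0 <= \sum_i `|u 0 i| by apply: sumr_ge0.
  exists (Num.bound (\sum_i `|u 0 i|)) => // i.
  apply: le_trans (_ : \sum_i `|u 0 i| <= _).
    by rewrite (bigD1 i) //= lerDl sumr_ge0.
  by apply: ltW; apply: lt_le_trans (archi_boundP S0) _; rewrite ler_nat.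
apply: le_trans (vol_bigcup _) _; rewrite eseries0 // => n _ _.
have tri : pos_triangular (n.+1%:R%:M : 'M[R]_d).
  split=> [i j ji|i]; rewrite mxE ?eqxx ?ltr0n //.
  by rewrite -val_eqE /= (gtn_eqF ji).
have := volume_scaling_triangular d0 tri 0 (cube 1); rewrite v0 mule0 => <-.
congr vol; apply/seteqP; split=> [u un|_ [u u1 <-] i].
  exists (n.+1%:R^-1 *: u).
    move=> i; rewrite mxE normrM gtr0_norm ?invr_gt0 ?ltr0n // ler_pdivrMl ?ltr0n //.
    by rewrite mulr1; exact: un.
  by rewrite add0r mul_mx_scalar scalerA divff ?pnatr_eq0 // scale1r.
by rewrite add0r mul_mx_scalar mxE normrM ger0_norm // ler_piMr //; exact: u1.
Qed.

(** The left factor is diagonal and multiplies row [i0] of [L], a single edge, by the ratio that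
    makes the determinant exactly [c]. *)
Definition shrunk_parall (R : realType) d (i0 : 'I_d) (c : R) (z : 'rV[R]_(d + d * d)) :=
  let L := vec_mx (rsubmx z) in
  parall (lsubmx z) (row_op ((c / \prod_i L i i) *: delta_mx 0 i0) i0 *m L).

Lemma shrunk_parallP (R : realType) d (i0 : 'I_d) (c : R) (F : set 'rV[R]_d) z :
  0 < c -> lifted c F z ->
  [/\ convex_body (shrunk_parall i0 c z),
      vol (shrunk_parall i0 c z) = (c%:E * vol (@cube R d 1))%E
    & shrunk_parall i0 c z `<=` F].
Proof.
move=> c0 [triL detL subL]; rewrite /shrunk_parall.
set L := vec_mx _ in triL detL subL *; set x := lsubmx z in subL *.
have d0 : (0 < d)%N by apply: leq_ltn_trans (ltn_ord i0).
have P0 : 0 < \prod_i L i i by apply: lt_le_trans detL.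
set k := c / _; have k0 : 0 < k by rewrite divr_gt0.
have k1 : k <= 1 by rewrite ler_pdivrMr // mul1r.
set D := row_op _ _.
have Dii i : D i i = if i == i0 then k else 1.
  by rewrite !mxE; case: (i == i0); rewrite eqxx ?mulr1.
have triD : pos_triangular D.
  split=> [i j ji|i]; last by rewrite Dii; case: ifP.
  have ij : (i == j) = false by rewrite -val_eqE /= (gtn_eqF ji).
  rewrite !mxE ij; case: (eqVneq i i0) => // <-.
  by rewrite [j == i]eq_sym ij andbF mulr0.
have [triDL detDL] := pos_triangular_mul triD triL.
have detE : \prod_i (D *m L) i i = c.
  rewrite detDL (eq_bigr _ (fun i _ => Dii i)) -big_mkcond big_pred1_eq /k divfK //.
  by rewrite gt_eqF.
split.
- split; first exact: compact_parall.
  split; first exact: convex_parall.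
  by exists x; apply: interior_parall; apply: pos_triangular_unit.
- by rewrite -[in RHS]detE -(volume_scaling_triangular d0 triDL x).
- move=> _ [u u1 <-]; apply: subL; exists (u *m D); last by rewrite mulmxA.
  move=> j; rewrite mul_row_op !mxE eqxx /=; case: eqP => _.
    rewrite mulr1 addr0 normrM (gtr0_norm k0) -[leRHS]mulr1.
    by apply: ler_pM => //; apply: ltW.
  by rewrite !mulr0 add0r; exact: u1.
Qed.

Lemma fat_mono (R : realType) d (K K' : set 'rV[R]_d) c c' :
  K `<=` K' -> c' <= c -> fat K c -> fat K' c'.
Proof.
move=> KK' cc' [x [L [triL detL subL]]]; exists x, L; split=> //.
  exact: le_trans detL.
exact: subset_trans KK'.
Qed.

(** * From the intersection hypothesis to the lifted family *)

Definition many_intersect (R : realType) d n (F : 'I_n -> set 'rV[R]_d) p :=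
  forall I : {set 'I_n}, #|I| = p ->
    exists J : {set 'I_n}, [/\ J \subset I, #|J| = d.+1 &
      (1%:E <= vol [set x | forall j, j \in J -> F j x])%E].

Lemma many_intersect_transversal (R : realType) d n (F : 'I_n -> set 'rV[R]_d) p
    (f : 'I_p -> 'I_n) : many_intersect F p -> injective f ->
  exists2 e : 'I_d.+1 -> 'I_p, injective e &
    (1%:E <= vol [set x | forall l, F (f (e l)) x])%E.
Proof.
move=> HF fi.
have [J [JI J1 vJ]] := HF (f @: [set: 'I_p])%SET (etrans (card_imset _ fi) (etrans (cardsT _) (card_ord p))).
pose A := [pred i | f i \in J].
have JA : (d.+1 <= #|A|)%N.
  rewrite -J1; apply: leq_trans (leq_imset_card f A); apply: subset_leq_card.
  apply/fintype.subsetP => j jJ; have /imsetP[i _ jE] := fintype.subsetP JI _ jJ.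
  by apply/imsetP; exists i; rewrite // inE -jE.
have [e ei eA] := card_injection JA.
exists e => //; apply: le_trans vJ _; apply: le_vol => x Fx l.
by apply: Fx; have := eA l; rewrite inE.
Qed.

(** A transversal of the [p] classes is coloured by [d.+1] classes whose members meet in volume at
    least 1. On a subgrid where this colour is constant, these classes satisfy the hypothesis of
    [rainbow_fat]. *)
Lemma fat_subfamily (R : realType) d : (0 < d)%N -> exists2 c : R, 0 < c & forall p N,
  exists t, forall n (F : 'I_n -> set 'rV[R]_d), (forall i, convex (F i)) ->
  many_intersect F p -> forall f : 'I_p -> 'I_t -> 'I_n,
  (forall i i' j j', f i j = f i' j' -> i = i' /\ j = j') ->
  exists i (u : 'I_N -> 'I_t), injective u /\ fat [set x | forall j, F (f i (u j)) x] c.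
Proof.
move=> d0; have [c0 c00 Hc0] := fat_of_volume R d0.
have [cd cd0 Hcd] := rainbow_fat_exists R d.
have [cf cf0 Hcf] := rfat_fat R d.
exists (cf * (cd * c0)); first by rewrite !mulr_gt0.
(* Asking for [N.+1] makes [t1] positive and so provides a default index for the classes outside the
   range of [a]. *)
move=> p N; have [t1 [leN Ht1]] := Hcd N.+1.
have [t Ht] := product_ramsey p t1 {ffun 'I_d.+1 -> 'I_p}.
exists t => n F cF HF f fi.
have /choice[chi chiP] : forall y : 'I_p -> 'I_t, exists e : {ffun 'I_d.+1 -> 'I_p},
    injective e /\ (1%:E <= vol [set x | forall l, F (f (e l) (y (e l))) x])%E.
  move=> y; have [|e ei ve] := @many_intersect_transversal R d n F p (fun i => f i (y i)) HF.
    by move=> i i' /fi[].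
  exists (finfun e); split; first by move=> l l'; rewrite !ffunE => /ei.
  by apply: le_trans ve _; apply: le_vol => x Fx l; rewrite ffunE.
have [e [a [ei chia]]] := Ht t (leqnn t) chi.
have t10 : (0 < t1)%N by apply: leq_trans leN.
have ai : injective a.
  by have := chia (fun=> Ordinal t10) => <-; case: (chiP (fun i => e i (Ordinal t10))).
pose K l s := F (f (a l) (e (a l) s)).
have [|y|l [u [ui Hu]]] := Ht1 K c0 c00.
- by move=> l s; apply: cF.
- apply: fat_rfat; apply: Hc0; first by apply: convex_bigcap => l; apply: cF.
  pose y' i := if [pick l | a l == i] is Some l then y l else Ordinal t10.
  have y'E l : y' (a l) = y l.
    by rewrite /y'; case: pickP => [l' /eqP/ai -> //|/(_ l)]; rewrite eqxx.
  have [_] := chiP (fun i => e i (y' i)); rewrite chia => /le_trans; apply.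
  by apply: le_vol => x Fx l; rewrite /K -y'E; apply: Fx.
exists (a l), (fun j => e (a l) (u (widen_ord (leqnSn N) j))); split.
  by move=> j j' /ei/ui/(congr1 val) jj'; apply: val_inj.
apply: fat_mono (lexx _) (Hcf _ _ _ Hu).
  by move=> x Kx j; apply: Kx.
by apply: convex_bigcap => j; apply: cF.
Qed.

Lemma lifted_fat_exists (R : realType) d c n (F : 'I_n -> set 'rV[R]_d) N (f : 'I_N -> 'I_n) :
  fat [set x | forall j, F (f j) x] c -> exists z, forall j, lifted c (F (f j)) z.
Proof.
move=> [x [L [triL detL subL]]]; exists (row_mx x (mxvec L)) => j.
by apply: lifted_fat => // y /subL; apply.
Qed.

(* A tuple of indices either repeats one index often, or contains many distinct
   indices. *)
Lemma lifted_pq (R : realType) d : (0 < d)%N -> exists2 c : R, 0 < c & forall p N,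
  exists p', forall n (F : 'I_n -> set 'rV[R]_d),
  (forall i, convex (F i)) -> (forall i, (1%:E <= vol (F i))%E) -> many_intersect F p ->
  forall g : 'I_p' -> 'I_n, exists2 e : 'I_N -> 'I_p', injective e &
    exists z, forall l, lifted c (F (g (e l))) z.
Proof.
move=> d0; have [c0 c00 Hc0] := fat_of_volume R d0.
have [c1 c10 Hc1] := fat_subfamily R d0.
exists (Num.min c0 c1); first by rewrite lt_min c00.
move=> p [|N']; first by exists 0%N => n F _ _ _ g; exists id; [|exists 0 => -[]].
set N := N'.+1; have [t Ht] := Hc1 p N.
exists (p * t * N)%N => n F cF vF HF g.
pose I : finType := {i : 'I_n | i \in codom g}.
have [ltI|geI] := ltnP (#|I| * N) (p * t * N).
  pose g' s : I := exist _ (g s) (codom_f g s).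
  have [|i0 Ni0] := @pigeonhole_fiber _ _ g' N; first by rewrite card_ord.
  have [e ei eP] := card_injection Ni0; exists e => //.
  apply: lifted_fat_exists; apply: fat_mono (Hc0 _ (cF (val i0)) (vF _)).
    move=> x Fx l; have := eP l; rewrite inE => /eqP/(congr1 val) /= -> //.
  by rewrite ge_min lexx.
rewrite leq_pmul2r // in geI.
have [h hi _] := @card_injection I predT (p * t) geI.
have /choice[q qP] : forall i : I, exists s, g s = val i.
  by move=> [i gi]; have /codomP[s is_] := gi; exists s.
(* Positions of [p * t] distinct sets, arranged as [p] classes of size [t]. *)
pose k (i : 'I_p) (j : 'I_t) := q (h (mxvec_index i j)).
have gk i j : g (k i j) = val (h (mxvec_index i j)) by rewrite qP.
have ki i i' j j' : g (k i j) = g (k i' j') -> i = i' /\ j = j'.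
  rewrite !gk => /val_inj/hi E; have [v vK _] := curry_mxvec_bij p t.
  have [] : (i, j) = (i', j') by rewrite -(vK (i, j)) // -(vK (i', j')) //= E.
  by [].
have [i [u [ui fatu]]] := Ht n F cF HF (fun i j => g (k i j)) ki.
exists (fun l => k i (u l)); first by move=> l l' /(congr1 g)/ki[_ /ui].
apply: lifted_fat_exists; apply: fat_mono fatu => //.
by rewrite ge_min lexx orbT.
Qed.

Theorem theorem3 (R : realType) :
  forall d : nat, (0 < d)%N ->
  exists v : R, 0 < v /\
  forall p : nat, (d.+1 <= p)%N ->
  exists r : nat,
  forall (n : nat) (F : 'I_n -> set 'rV[R]_d),
    (forall i, convex (F i)) ->
    (forall i, (1%:E <= vol (F i))%E) ->
    (forall I : {set 'I_n}, #|I| = p ->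
       exists J : {set 'I_n}, [/\ J \subset I, #|J| = d.+1 &
         (1%:E <= vol [set x | forall j, j \in J -> F j x])%E]) ->
    exists T : seq (set 'rV[R]_d),
      (size T <= r)%N /\ quant_transversal v T F.
Proof.
move=> d d0.
have [c c0 Hc] := lifted_pq R d0.
have D0 : (0 < d + d * d)%N by rewrite addn_gt0 d0.
(* In this case no set has volume at least 1, the family is empty, and any positive [v] will do. *)
have [v0|v0] := eqVneq (vol (@cube R d 1)) 0%E.
  exists 1; split=> // p _; exists 0%N => n F _ vF _; exists [::]; split=> //.
  by split=> // i; move: (vF i); rewrite (vol_cube_eq0 _ d0 v0) lee_fin ler10.
have [w wE] : exists w : R, vol (@cube R d 1) = w%:E.
  exists (fine (vol (@cube R d 1))); rewrite fineK // ge0_fin_numE ?vol_ge0 //.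
  by apply: le_lt_trans (vol_cube_le d0 ler01) _; apply: ltry.
have w0 : 0 < w.
  by rewrite lt_neqAle -lee_fin -wE vol_ge0 andbT -eqe -wE eq_sym.
exists (c * w); split=> [|p _]; first exact: mulr_gt0.
have [p' Hp'] := Hc p (d + d * d).+1.
have [r Hr] := pq_theorem R p' D0.
exists r => n F cF vF HF.
have [|Z szZ ZF] := Hr _ (fun i => lifted c (F i)) (fun i => convex_lifted c0 (cF i)).
  exact: Hp'.
pose i0 : 'I_d := Ordinal d0.
(* A point outside all lifted sets need not encode a parallelepiped, so its body could fail to have
   the required volume. *)
pose used z := `[< exists i, lifted c (F i) z >].
exists [seq shrunk_parall i0 c z | z <- Z & used z]; split.
  by rewrite size_map size_filter (leq_trans (count_size _ _)).
split=> [K /mapP[z]|i].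
  rewrite mem_filter => /andP[/asboolP[i Fz] _] ->.
  have [bz vz _] := shrunk_parallP i0 c0 Fz.
  by split=> //; rewrite vz wE.
have [z zZ Fz] := ZF i; exists (shrunk_parall i0 c z).
  by apply: map_f; rewrite mem_filter zZ andbT; apply/asboolP; exists i.
by have [] := shrunk_parallP i0 c0 Fz.
Qed.
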